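(* Let $V$ be a countable vertex set and let $(c_t)_{t\in[0,\infty)}$ be a deterministic family of symmetric conductances on $V$, non-decreasing in $t$, with limit $c_\infty$ (i.e. $c_t(u,v)\uparrow c_\infty(u,v)$ as $t\to\infty$ for all $u,v$), where $\pi_\infty(v)=\sum_z c_\infty(v,z)<\infty$ for every $v\in V$. Let $(X_t)_{t\ge0}$ be the continuous-time random walk in the changing environment $(c_t)_{t\ge0}$, started at an arbitrary vertex. If the random walk on $(V,c_\infty)$ is irreducible and recurrent, then almost surely $(X_t)_{t\ge0}$ does not explode, i.e. it makes finitely many jumps in every bounded time interval, and is recurrent, in the sense that $\{t\ge0:X_t=v\}$ is unbounded for all $v\in V$.
   Context: Conductances are symmetric functions $c:V\times V\to[0,\infty)$ with $c(v,v)=0$ (no loops, as loops do not affect the dynamics) and finite total conductance $\pi(y)=\sum_z c(y,z)$ at every vertex; vertices may have infinitely many neighbors. The continuous-time random walk in the changing environment $(c_t)_{t\ge0}$: each edge $e$ carries an independent Poisson clock with (time-dependent) rate $c_t(e)$ at time $t$; when a clock rings and the walk is at an endpoint of that edge, the walk traverses the edge. Thus at time $t$ the walk at $y$ jumps to $z$ at rate $c_t(y,z)$. If $T_n$ is the time of the $n$-th jump, the explosion time is $\zeta=\lim_{n\to\infty}T_n\in[0,\infty]$ (with $\zeta=\infty$ if there are only finitely many jumps); the walk explodes if $\zeta<\infty$. The random walk on the fixed network $(V,c_\infty)$ jumps from $y$ to $z$ with probability $c_\infty(y,z)/\pi_\infty(y)$. *)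

(* Defs.v *)
From HB Require Import structures.
From mathcomp Require Import all_boot all_order all_algebra finmap.
From mathcomp Require Import all_classical all_reals all_analysis.
From mathcomp Require Import measurable_realfun.

Set Implicit Arguments.
Unset Strict Implicit.
Unset Printing Implicit Defensive.

Import Order.TTheory GRing.Theory Num.Theory.
Import numFieldNormedType.Exports.

Local Open Scope classical_set_scope.
Local Open Scope ring_scope.
Local Open Scope card_scope.

Definition total_conductance (R : realType) (V : countType)
    (c : V -> V -> R) (y : V) : \bar R :=
  (\esum_(z in [set: V]) (c y z)%:E)%E.

Record conductances (R : realType) (V : countType) (c : V -> V -> R) : Prop := {
  conductances_sym : forall u v, c u v = c v u ;
  conductances_ge0 : forall u v, 0 <= c u v ;
  conductances_noloop : forall v, c v v = 0 ;
  conductances_fin : forall v, (total_conductance c v < +oo)%E }.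

(* The quotient c(y,z)/pi(y) is meaningless at an isolated vertex y; the walk
   stays put there.  Under irreducibility this only concerns #|V| = 1. *)
Definition step (R : realType) (V : countType) (c : V -> V -> R)
    (y z : V) : \bar R :=
  if total_conductance c y == 0%E then ((y == z)%:R)%:E
  else (c y z / fine (total_conductance c y))%:E.

(* P_x(Y_n = y) *)
Fixpoint nstep (R : realType) (V : countType) (c : V -> V -> R)
    (n : nat) (x y : V) : \bar R :=
  if n is m.+1 then
    (\esum_(z in [set: V]) (step c x z * nstep c m z y))%E
  else ((x == y)%:R)%:E.

(* P_x(Y_1 <> y, ..., Y_n <> y, Y_(n+1) = y) *)
Fixpoint first_hit (R : realType) (V : countType) (c : V -> V -> R)
    (n : nat) (x y : V) : \bar R :=
  if n is m.+1 then
    (\esum_(z in [set z | z != y]) (step c x z * first_hit c m z y))%E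
  else step c x y.

Definition network_irreducible (R : realType) (V : countType)
    (c : V -> V -> R) : Prop :=
  forall x y, exists n, (0 < nstep c n x y)%E.

(* The walk started at x returns to x with probability 1. *)
Definition network_recurrent (R : realType) (V : countType)
    (c : V -> V -> R) : Prop :=
  forall x, (\sum_(0 <= n <oo) first_hit c n x x = 1)%E.

Definition mutually_independent (d : measure_display) (Omega : measurableType d)
    (R : realType) (P : probability Omega R) (I : choiceType) (D : set I)
    (F : I -> set (set Omega)) : Prop :=
  forall (J : {fset I}) (A : I -> set Omega),
    (forall i, i \in J -> D i /\ F i (A i)) ->
    (P (\bigcap_(i in [set` J]) A i) = \prod_(i <- J) P (A i))%E.

(* N w is the random set of ring times of a clock. *)
Definition rings (R : realType) (Omega : Type) (N : Omega -> set R)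
    (s t : R) (k : nat) : set Omega :=
  [set w | (N w `&` `]s, t]) #= `I_k].

(* The Poisson weights are written out because poisson_pmf 0 k is 1 for every k
   in the library, whereas intervals of zero intensity must have no ring. *)
Record poisson_clock (d : measure_display) (Omega : measurableType d)
    (R : realType) (P : probability Omega R) (N : Omega -> set R)
    (rate : R -> R) : Prop := {
  poisson_clock_meas : forall s t k, 0 <= s -> s <= t ->
    measurable (rings N s t k) ;
  poisson_clock_law : forall s t k, 0 <= s -> s <= t ->
    let L := \int[lebesgue_measure]_(r in `]s, t]) rate r in
    P (rings N s t k) = (L ^+ k / k`!%:R * expR (- L))%:E ;
  poisson_clock_indep : forall t_ : nat -> R, 0 <= t_ 0%N ->
    {homo t_ : i j / (i <= j)%N >-> i <= j} ->
    mutually_independent P [set: nat]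
      (fun i => [set rings N (t_ i) (t_ i.+1) k | k in [set: nat]]) }.

Definition clock_sigma_algebra (R : realType) (Omega : Type)
    (N : Omega -> set R) : set (set Omega) :=
  <<s [set A | exists s t k, [/\ 0 <= s, s <= t & A = rings N s t k] ] >>.

(* Edges are the two-element subsets of V. *)
Record independent_clocks (d : measure_display) (Omega : measurableType d)
    (R : realType) (P : probability Omega R) (V : countType)
    (c : R -> V -> V -> R) (N : {fset V} -> Omega -> set R) : Prop := {
  clocks_poisson : forall u v, u != v ->
    poisson_clock P (N [fset u; v]%fset) (fun t => c t u v) ;
  clocks_indep : mutually_independent P [set e : {fset V} | #|` e| = 2%N]
    (fun e => clock_sigma_algebra (N e)) }.

(* The first time after a at which some edge incident to y rings; +oo if there
   is none. *)
Definition next_ring (R : realType) (V : countType) (N : {fset V} -> set R)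
    (y : V) (a : \bar R) : \bar R :=
  ereal_inf [set s%:E | s in
    [set s : R | (a < s%:E)%E /\ exists2 z, z != y & N [fset y; z]%fset s]].

(* T n is the time of the n-th jump (+oo if there are fewer than n jumps), and
   Y n the vertex reached by that jump; Y n is irrelevant when T n = +oo. *)
Record follows_clocks (R : realType) (V : countType) (N : {fset V} -> set R)
    (x0 : V) (T : nat -> \bar R) (Y : nat -> V) : Prop := {
  follows_time0 : T 0%N = 0%E ;
  follows_start : Y 0%N = x0 ;
  follows_time : forall n, T n.+1 = next_ring N (Y n) (T n) ;
  follows_jump : forall n s, T n.+1 = s%:E ->
    [/\ (T n < s%:E)%E, Y n.+1 != Y n & N [fset Y n; Y n.+1]%fset s] }.

(* The edges at a vertex almost surely have finitely many rings in bounded time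
   and never ring simultaneously, so the clocks determine T and Y almost surely;
   on the exceptional null event nothing is required of T and Y. *)
Record random_walk (d : measure_display) (Omega : measurableType d)
    (R : realType) (P : probability Omega R) (V : countType)
    (c : R -> V -> V -> R) (N : {fset V} -> Omega -> set R) (x0 : V)
    (T : nat -> Omega -> \bar R) (Y : nat -> Omega -> V) : Prop := {
  walk_clocks : independent_clocks P c N ;
  walk_time_meas : forall n, measurable_fun [set: Omega] (T n) ;
  walk_pos_meas : forall n v, measurable [set w | Y n w = v] ;
  walk_follows : {ae P, forall w,
    follows_clocks (fun e => N e w) x0 (fun n => T n w) (fun n => Y n w)} }.

(* X_t = v, i.e. v is the vertex occupied between two successive jumps around t *)
Definition at_vertex (R : realType) (V : countType) (T : nat -> \bar R)
    (Y : nat -> V) (t : R) (v : V) : Prop :=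
  exists n, (T n <= t%:E < T n.+1)%E /\ Y n = v.

Definition explosion_time (R : realType) (T : nat -> \bar R) : \bar R :=
  lim (T n @[n --> \oo]).

(* Main.v *)
Require Import Defs.
From HB Require Import structures.
From mathcomp Require Import all_boot all_order all_algebra finmap.
From mathcomp Require Import all_classical all_reals all_analysis.
From mathcomp Require Import measurable_realfun ring lra.
Import Order.TTheory GRing.Theory Num.Theory.
Import numFieldNormedType.Exports.
Local Open Scope classical_set_scope.
Local Open Scope ring_scope.

Set Implicit Arguments.
Unset Strict Implicit.
Unset Printing Implicit Defensive.
(* A finite-volume, backward-in-time energy argument on the grid t_i = i * eta.
   Recurrence of the limit network gives, for each eps, a function g with finite
   support, g v = 1 and Dirichlet energy at most eps for cinf.  In a finite box,
   let h i x be the probability that the (discretised, killed) walk at x at time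
   t_i visits v at some grid time in [s, t_m].  After time s, h = w - r, where w
   solves the same backward equation with terminal value g and r has terminal
   value g - 1_v and vanishes at v.  As the conductances increase in time, each
   backward step only decreases the energy: the energy of w stays below eps,
   while the energy of r, being dissipated from the finite norm |g|^2, is
   O(1 / (t_m - s)).  So h has small energy at time s, and h v = 1 forces h x0
   close to 1 at time s, since x0 is joined to v by a path of edges that are
   already open.  From time s back to time 0 the total drift of h at x0 is, by
   Cauchy-Schwarz, at most the square root of s times that energy (per unit of
   time).  Hence v is almost surely visited after every time s, which yields
   both recurrence and non-explosion. *)

(** * The Dirichlet form of a finite box *)

Section DirichletForm.
Context (R : realFieldType) (V : eqType) (B : seq V).
Implicit Types (a : V -> V -> R) (k u w : V -> R).

(** Minus the generator of the walk on [B] with jump rates [a] and killing rates [k]; killing acts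
    as an extra edge to a cemetery where [u] is 0. *)
Definition laplacian a k u (x : V) : R :=
  \sum_(y <- B) a x y * (u x - u y) + k x * u x.

Definition dirichlet a k u w : R :=
  2^-1 * (\sum_(x <- B) \sum_(y <- B) a x y * (u x - u y) * (w x - w y))
  + \sum_(x <- B) k x * u x * w x.

(** Green's formula: by symmetry of [a], exchanging the two summation variables replaces [w x] by
    [- w y], and averaging the two forms gives the factor 1/2. *)
Lemma sum_laplacian a k u w : (forall x y, a x y = a y x) ->
  \sum_(x <- B) w x * laplacian a k u x = dirichlet a k u w.
Proof.
move=> a_sym; rewrite /dirichlet.
have -> : \sum_(x <- B) w x * laplacian a k u x =
    \sum_(x <- B) \sum_(y <- B) w x * (a x y * (u x - u y)) +
    \sum_(x <- B) k x * u x * w x.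
  rewrite -big_split; apply: eq_bigr => x _ /=.
  by rewrite /laplacian mulrDr -mulr_sumr; congr (_ + _); ring.
congr (_ + _); set A := LHS.
have A2 : A = \sum_(x <- B) \sum_(y <- B) - (w y * (a x y * (u x - u y))).
  rewrite /A exchange_big /=; apply: eq_bigr => x _; apply: eq_bigr => y _.
  by rewrite (a_sym y x); ring.
suff -> : \sum_(x <- B) \sum_(y <- B) a x y * (u x - u y) * (w x - w y) = A + A.
  by field.
rewrite {2}A2 /A -big_split; apply: eq_bigr => x _ /=.
by rewrite -big_split; apply: eq_bigr => y _ /=; ring.
Qed.

Lemma dirichletC a k u w : dirichlet a k u w = dirichlet a k w u.
Proof.
rewrite /dirichlet; congr (_ * _ + _); apply: eq_bigr => x _; last by ring.
by apply: eq_bigr => y _; ring.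
Qed.

Lemma dirichletBl a k u u' w :
  dirichlet a k (fun x => u x - u' x) w = dirichlet a k u w - dirichlet a k u' w.
Proof.
rewrite /dirichlet opprD addrACA -mulrBr -!sumrB; congr (_ * _ + _);
  apply: eq_bigr => x _; last by ring.
by rewrite -sumrB; apply: eq_bigr => y _; ring.
Qed.

Lemma dirichlet_ge0 a k u : (forall x y, 0 <= a x y) ->
  {in B, forall x, 0 <= k x} -> 0 <= dirichlet a k u u.
Proof.
move=> a0 k0; rewrite addr_ge0 ?mulr_ge0 ?invr_ge0 ?ler0n//.
  apply: sumr_ge0 => x _; apply: sumr_ge0 => y _.
  by rewrite -mulrA mulr_ge0// -expr2 sqr_ge0.
rewrite big_seq; apply: sumr_ge0 => x xB.
by rewrite -mulrA mulr_ge0 ?k0// -expr2 sqr_ge0.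
Qed.

Lemma le_dirichlet a a' k k' u : (forall x y, a x y <= a' x y) ->
  {in B, forall x, k x <= k' x} -> dirichlet a k u u <= dirichlet a' k' u u.
Proof.
move=> aa' kk'; rewrite lerD//.
  rewrite ler_wpM2l ?invr_ge0 ?ler0n//.
  apply: ler_sum => x _; apply: ler_sum => y _.
  by rewrite -!mulrA ler_wpM2r// -expr2 sqr_ge0.
rewrite big_seq [leRHS]big_seq; apply: ler_sum => x xB.
by rewrite -!mulrA ler_wpM2r ?kk'// -expr2 sqr_ge0.
Qed.

(** Parallelogram law, in which the energy of [u + w] is dropped because it is nonnegative. *)
Lemma dirichletB_le a k u w : (forall x y, 0 <= a x y) ->
  {in B, forall x, 0 <= k x} ->
  dirichlet a k (fun x => u x - w x) (fun x => u x - w x) <=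
  2 * (dirichlet a k u u + dirichlet a k w w).
Proof.
move=> a0 k0; rewrite dirichletBl !(dirichletC a k _ (fun x => u x - w x)).
rewrite !dirichletBl (dirichletC a k w u).
(* The sum [u + w] is written as a difference so that [dirichletBl] expands it. *)
have := dirichlet_ge0 (fun x => u x - (- w x)) a0 k0.
rewrite dirichletBl !(dirichletC a k _ (fun x => u x - (- w x))) !dirichletBl.
have E v v' : dirichlet a k (fun x => - v x) v' = - dirichlet a k v v'.
  have := dirichletBl a k (fun=> 0) v v'.
  rewrite [X in _ = X - _](_ : _ = 0) ?sub0r.
    by move=> <-; congr (dirichlet _ _ _ _); apply: boolp.funext => x; rewrite sub0r.
  rewrite /dirichlet !big1 ?mulr0 ?addr0// => x _; first by rewrite mulr0 mul0r.
  by apply: big1 => y _; rewrite subrr mulr0 mul0r.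
by rewrite (dirichletC a k u) !E (dirichletC a k w (fun x => - w x)) E (dirichletC a k w u); lra.
Qed.

(** Stability of the explicit scheme: [(u x - u y)^2 <= 2 u x^2 + 2 u y^2] bounds the energy by the
    sum of [u x^2 * (2 * sum_y a x y + k x)], and [half] makes the last factor at most 1. *)
Lemma dirichlet_le_norm a k u : (forall x y, a x y = a y x) ->
  (forall x y, 0 <= a x y) -> {in B, forall x, 0 <= k x} ->
  {in B, forall x, \sum_(y <- B) a x y + k x <= 2^-1} ->
  dirichlet a k u u <= \sum_(x <- B) u x ^+ 2.
Proof.
move=> a_sym a0 k0 half.
have H : \sum_(x <- B) \sum_(y <- B) a x y * (u x - u y) * (u x - u y) <=
    4 * \sum_(x <- B) u x ^+ 2 * \sum_(y <- B) a x y.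
  have S : \sum_(x <- B) \sum_(y <- B) a x y * u y ^+ 2 =
           \sum_(x <- B) u x ^+ 2 * \sum_(y <- B) a x y.
    rewrite exchange_big /=; apply: eq_bigr => x _; rewrite mulr_sumr.
    by apply: eq_bigr => y _; rewrite a_sym mulrC.
  apply: (@le_trans _ _ (\sum_(x <- B) \sum_(y <- B)
      (2 * (u x ^+ 2 * a x y) + 2 * (a x y * u y ^+ 2)))).
    apply: ler_sum => x _; apply: ler_sum => y _.
    have := a0 x y; have := sqr_ge0 (u x + u y); rewrite !expr2; nra.
  rewrite le_eqVlt; apply/orP; left; apply/eqP.
  under eq_bigr do rewrite big_split/= -!mulr_sumr.
  by rewrite big_split/= -!mulr_sumr S; ring.
have K : 2 * (\sum_(x <- B) u x ^+ 2 * \sum_(y <- B) a x y)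
    + \sum_(x <- B) k x * u x * u x <= \sum_(x <- B) u x ^+ 2.
  rewrite mulr_sumr -big_split big_seq [leRHS]big_seq; apply: ler_sum => x xB /=.
  have := half x xB; have := k0 x xB; have := sqr_ge0 (u x); rewrite !expr2.
  have : 0 <= \sum_(y <- B) a x y by apply: sumr_ge0.
  nra.
rewrite /dirichlet; lra.
Qed.

(* One step of the backward equation for the walk stopped on [stop]. *)
Definition backward a k (stop : pred V) u (x : V) : R :=
  u x - (if stop x then 0 else laplacian a k u x).

Section Step.
Context a k (stop : pred V) (u : V -> R).
Hypotheses (a_sym : forall x y, a x y = a y x) (a0 : forall x y, 0 <= a x y)
  (k0 : {in B, forall x, 0 <= k x})
  (half : {in B, forall x, \sum_(y <- B) a x y + k x <= 2^-1}).
Let u' := backward a k stop u.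

(** Write [u' = u - z]. As [z] is the Laplacian of [u] off [stop] and 0 on it, Green's formula gives
    [E(u,z) = |z|^2], so [E(u') = E(u) - 2|z|^2 + E(z)] with [E(z) <= |z|^2]. *)
Lemma dirichlet_backward :
  dirichlet a k u' u' + \sum_(x <- B) (u' x - u x) ^+ 2 <= dirichlet a k u u.
Proof.
pose z x := if stop x then 0 else laplacian a k u x.
rewrite [dirichlet a k u' u'](_ : _ = dirichlet a k u u
    - 2 * dirichlet a k u z + dirichlet a k z z); last first.
  rewrite dirichletBl !(dirichletC a k _ u') !dirichletBl (dirichletC a k z u).
  ring.
have -> : dirichlet a k u z = \sum_(x <- B) z x ^+ 2.
  rewrite -sum_laplacian//; apply: eq_bigr => x _; rewrite /z.
  by case: ifP => _; rewrite ?mul0r ?expr0n// expr2.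
have -> : \sum_(x <- B) (u' x - u x) ^+ 2 = \sum_(x <- B) z x ^+ 2.
  by apply: eq_bigr => x _; rewrite /u' /backward -/(z x); ring.
by have := dirichlet_le_norm z a_sym a0 k0 half; lra.
Qed.

(** Since [u] vanishes on [stop], [|u'|^2 = |u|^2 - 2 E(u) + |u' - u|^2], and the previous lemma
    bounds the last term by [E(u)]. *)
Lemma norm_backward : (forall x, stop x -> u x = 0) ->
  \sum_(x <- B) u' x ^+ 2 + dirichlet a k u u <= \sum_(x <- B) u x ^+ 2.
Proof.
move=> u0; pose z x := if stop x then 0 else laplacian a k u x.
have E : \sum_(x <- B) u' x ^+ 2 = \sum_(x <- B) u x ^+ 2
    - 2 * dirichlet a k u u + \sum_(x <- B) (u' x - u x) ^+ 2.
  rewrite -sum_laplacian// mulr_sumr -sumrB -big_split; apply: eq_bigr => x _ /=.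
  rewrite /u' /backward; case: ifP => [/u0 ->|_]; last by ring.
  by rewrite !(mul0r, mulr0, subr0, expr0n, addr0).
have := dirichlet_backward; have := dirichlet_ge0 u' a0 k0; rewrite E.
lra.
Qed.

End Step.

Lemma backwardB a k stop u w x :
  backward a k stop (fun x => u x - w x) x =
  backward a k stop u x - backward a k stop w x.
Proof.
rewrite /backward; case: ifP => _; first by ring.
rewrite /laplacian [X in _ - (X + _)](_ : _ = \sum_(y <- B) a x y * (u x - u y) -
  \sum_(y <- B) a x y * (w x - w y)); first by ring.
by rewrite -sumrB; apply: eq_bigr => y _; ring.
Qed.

End DirichletForm.

(** * Energy estimates for the backward equation with increasing conductances *)

Section BackwardEquation.
Context (R : realFieldType) (V : eqType) (B : seq V).
Context (a : nat -> V -> V -> R) (k : V -> R) (stop : nat -> pred V).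
Hypotheses (a_sym : forall i x y, a i x y = a i y x)
  (a0 : forall i x y, 0 <= a i x y)
  (a_mono : forall i x y, a i x y <= a i.+1 x y)
  (k0 : {in B, forall x, 0 <= k x})
  (half : forall i, {in B, forall x, \sum_(y <- B) a i x y + k x <= 2^-1}).

Let D i u := dirichlet B (a i) k u u.

Let D_mono i u : D i u <= D i.+1 u.
Proof. exact: le_dirichlet. Qed.

Section Solution.
Context (u : nat -> V -> R) (m : nat).
Hypothesis u_eq : forall i, (i < m)%N ->
  u i = backward B (a i) k (stop i) (u i.+1).

Lemma energy_backward i n : (i + n <= m)%N ->
  D i (u i) + \sum_(j < n) \sum_(x <- B) (u (i + j)%N x - u (i + j).+1 x) ^+ 2 <=
  D (i + n) (u (i + n)%N).
Proof.
elim: n => [|n IHn]; first by rewrite big_ord0 addr0 addn0.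
rewrite addnS => inm; rewrite big_ord_recr /= addrA.
apply: le_trans (D_mono _ _).
apply: le_trans (dirichlet_backward (stop (i + n)%N)
  (u (i + n).+1) (a_sym _) (a0 _) k0 (half _)).
by rewrite -u_eq// lerD2r IHn// ltnW.
Qed.

Lemma energy_backward_le i n : (i + n <= m)%N ->
  D i (u i) <= D (i + n) (u (i + n)%N).
Proof.
move=> /energy_backward; apply: le_trans; rewrite lerDl.
by do 2![apply: sumr_ge0 => ? _]; rewrite sqr_ge0.
Qed.

(** The energy lost over the [n] steps controls the sum of the squared increments; Cauchy-Schwarz on
    the telescoping sum at [x] costs the factor [n]. *)
Lemma drift_backward n x : (n <= m)%N -> x \in B ->
  (u 0 x - u n x) ^+ 2 <= n%:R * D n (u n).
Proof.
move=> nm xB; have /(_ nm) := @energy_backward 0 n.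
set S := \sum_(j < n) _ => H.
have {H} : S <= D n (u n).
  by apply: le_trans H; rewrite lerDr dirichlet_ge0.
move=> /(ler_wpM2l (ler0n R n)); apply: le_trans.
have -> : u 0%N x - u n x = \sum_(j < n) (u j x - u j.+1 x).
  elim: n {S nm} => [|n IHn]; first by rewrite big_ord0 subrr.
  by rewrite big_ord_recr /= -IHn; ring.
have CS (F : nat -> R) : (\sum_(j < n) F j) ^+ 2 <= n%:R * \sum_(j < n) F j ^+ 2.
  elim: n {S nm} => [|n IHn]; first by rewrite !big_ord0 expr0n mul0r.
  rewrite !big_ord_recr /=; set s := \sum_(i < n) F i in IHn *.
  set q := \sum_(i < n) _ in IHn *; rewrite -natr1.
  have q0 : 0 <= q by apply: sumr_ge0 => *; rewrite sqr_ge0.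
  (* The induction compares the two sides after multiplication by [n], so [n = 0] is separate. *)
  have [n0|n0] := eqVneq (n%:R : R) 0.
    move: IHn; rewrite n0 mul0r => IHn.
    have : s = 0 by apply/eqP; rewrite -sqrf_eq0 eq_le IHn sqr_ge0.
    by move=> ->; rewrite add0r add0r mul1r; lra.
  have n1 : 0 < n%:R :> R by rewrite lt0r n0 ler0n.
  have := sqr_ge0 (s - n%:R * F n); rewrite !expr2 in IHn * => H.
  rewrite -(ler_pM2l n1); nra.
apply: le_trans (CS (fun j => u j x - u j.+1 x)) _.
rewrite ler_wpM2l// ler_sum// => j _; rewrite add0n.
rewrite (perm_big _ (perm_to_rem xB)) big_cons/= lerDl.
by apply: sumr_ge0 => ? _; rewrite sqr_ge0.
Qed.

(** Each backward step removes from the squared norm at least the current energy, which is never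
    below the energy at the earliest step [i]. *)
Lemma norm_backward_le i n : (i + n <= m)%N ->
  (forall j x, (i <= j < i + n)%N -> stop j x -> u j.+1 x = 0) ->
  n%:R * D i (u i) <= \sum_(x <- B) u (i + n)%N x ^+ 2.
Proof.
move=> inm u0; suff : n%:R * D i (u i) + \sum_(x <- B) u i x ^+ 2 <=
    \sum_(x <- B) u (i + n)%N x ^+ 2.
  by apply: le_trans; rewrite lerDl sumr_ge0// => *; rewrite sqr_ge0.
elim: n inm u0 => [|n IHn]; first by rewrite mul0r add0r addn0.
rewrite addnS => inm u0.
have {IHn} : n%:R * D i (u i) + \sum_(x <- B) u i x ^+ 2 <=
    \sum_(x <- B) u (i + n)%N x ^+ 2.
  apply: IHn => [|j y /andP[ij jn]]; first exact: ltnW.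
  by apply: u0; rewrite ij leqW.
have := norm_backward (stop := stop (i + n)%N) (u := u (i + n).+1) (a_sym (i + n)%N)
  (a0 _) k0 (half (i + n)%N) (fun x => u0 _ x _).
rewrite leq_addr ltnSn -u_eq// => /(_ isT).
have := dirichlet_backward (stop (i + n)%N) (u (i + n).+1)
  (a_sym (i + n)%N) (a0 _) k0 (half (i + n)%N).
rewrite -u_eq//.
have := energy_backward_le (ltnW inm).
rewrite -natr1 /D.
set S := \sum_(x <- B) (_ - _) ^+ 2.
have : 0 <= S by apply: sumr_ge0 => *; rewrite sqr_ge0.
lra.
Qed.

Lemma backward_stop i x : (i <= m)%N ->
  (forall j, (i <= j < m)%N -> stop j x) -> u i x = u m x.
Proof.
move=> im; rewrite -(subKn im); move: (m - i)%N (leq_subr i m) => n.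
elim: n => [|n IHn] nm st; first by rewrite subn0.
rewrite u_eq; last by rewrite ltn_subrL; case: m nm.
rewrite /backward st ?leqnn ?ltn_subrL/=; last by case: m nm.
rewrite subr0 -subSn// subSS IHn ?(ltnW nm)// => j /andP[nj jm].
by rewrite st// jm andbT (leq_trans _ nj)// leq_sub2l.
Qed.

End Solution.

(* [h i x] is the probability that the walk started at [x] at step [i] is at [v]
   at some step of [M, M + L]; [w] is the same with terminal value [g], so that
   [w - h] vanishes at [v]. *)
Lemma hitting_energy (v : V) (M L : nat) (g : V -> R) (h : nat -> V -> R) :
  (forall i, stop i =1 fun y => (M <= i)%N && (y == v)) ->
  (0 < L)%N -> g v = 1 -> (forall y, 0 <= g y <= 1) ->
  h (M + L)%N = (fun y => (y == v)%:R) ->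
  (forall i, (i < M + L)%N -> h i = backward B (a i) k (stop i) (h i.+1)) ->
  D M (h M) <= 2 * (D (M + L) g + (size B)%:R / L%:R).
Proof.
move=> stopE L0 gv g01 hT h_eq.
pose w i := nat_rect (fun=> V -> R) g
  (fun j => backward B (a (M + L - j.+1)%N) k (stop (M + L - j.+1)%N))
  (M + L - i)%N.
have w_eq i : (i < M + L)%N -> w i = backward B (a i) k (stop i) (w i.+1).
  move=> iML; rewrite /w; have -> : (M + L - i = (M + L - i.+1).+1)%N.
    by rewrite -subSn.
  by rewrite /=; congr (backward B (a _) k (stop _) _); rewrite -?subSn ?subSS ?subKn// ltnW.
have wT : w (M + L)%N = g by rewrite /w subnn.
have st j : (M <= j < M + L)%N -> stop j v by rewrite stopE eqxx => /andP[->].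
have wv j : (M <= j <= M + L)%N -> w j v = 1.
  move=> /andP[Mj jL]; rewrite (backward_stop w_eq)// ?wT// => l /andP[jl lL].
  by rewrite st// lL (leq_trans Mj).
have hv j : (M <= j <= M + L)%N -> h j v = 1.
  move=> /andP[Mj jL]; rewrite (backward_stop h_eq)// ?hT ?eqxx// => l /andP[jl lL].
  by rewrite st// lL (leq_trans Mj).
(* Both [w] and [h] equal 1 at [v] from step [M] on, so [r] vanishes where the equation is stopped
   and its norm dissipates. *)
pose r i y := w i y - h i y.
have r_eq i : (i < M + L)%N -> r i = backward B (a i) k (stop i) (r i.+1).
  by move=> iML; apply: boolp.funext => y; rewrite backwardB -w_eq// -h_eq.
have Dr : L%:R * D M (r M) <= (size B)%:R.
  apply: (@le_trans _ _ (\sum_(y <- B) r (M + L)%N y ^+ 2)).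
    apply: (norm_backward_le r_eq) => // j y /andP[Mj jL].
    rewrite stopE => /andP[_ /eqP ->].
    by rewrite /r wv ?hv ?subrr// jL leqW.
  (* The terminal value of [r] is [g] minus the indicator of [v], with entries in [-1, 1], so its
     squared norm is at most the size of [B]. *)
  rewrite -sum1_size natr_sum; apply: ler_sum => y _.
  rewrite /r wT hT expr_le1// ?ler_norml; have := g01 y; have [->|_] := eqVneq y v;
  rewrite /= ?gv; lra.
have -> : h M = fun y => w M y - r M y by apply: boolp.funext => y; rewrite /r; ring.
apply: le_trans (dirichletB_le _ _ (a0 _) k0) _.
rewrite ler_pM2l// lerD//.
  by rewrite -wT; apply: (energy_backward_le w_eq).
by rewrite ler_pdivlMr ?ltr0n// mulrC.
Qed.

End BackwardEquation.

(** * Functions of small energy on a recurrent network *)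

Section FiniteSums.
Context (R : realType) (V : choiceType).

Lemma sum_fset_le_esum (S : set V) (f : V -> \bar R) (B : {fset V}) :
  [set` B] `<=` S -> (\sum_(x <- B) f x <= \esum_(x in S) f x)%E.
Proof.
move=> BS; apply: ereal_sup_ubound; exists [set` B]; first by split.
by rewrite fsbig_finite//= set_fsetK.
Qed.

Lemma esum_le (S : set V) (f : V -> \bar R) (a : \bar R) :
  (forall B : {fset V}, [set` B] `<=` S -> (\sum_(x <- B) f x <= a)%E) ->
  (\esum_(x in S) f x <= a)%E.
Proof.
move=> H; apply: ge_ereal_sup => _ [A [finA AS] <-].
rewrite fsbig_finite//=; apply: H => x /=; rewrite in_fset_set// inE; exact: AS.
Qed.

Lemma lt_esum (S : set V) (f : V -> \bar R) (a : \bar R) :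
  (a < \esum_(x in S) f x)%E ->
  exists2 B : {fset V}, [set` B] `<=` S & (a < \sum_(x <- B) f x)%E.
Proof.
move=> aS; apply: contrapT => /forall2NP H.
move: aS; rewrite ltNge => /negP; apply; apply: esum_le => B BS.
by case: (H B) => // /negP; rewrite -leNgt.
Qed.

Lemma le_sum_fset (A B : {fset V}) (f : V -> R) : (A `<=` B)%fset ->
  (forall x, 0 <= f x) -> \sum_(x <- A) f x <= \sum_(x <- B) f x.
Proof.
move=> AB f0; rewrite [leRHS](big_fsetID _ (mem A)) /=.
rewrite (_ : [fset x in B | x \in A]%fset = A) ?lerDl ?sumr_ge0//.
apply/fsetP => x; rewrite !inE /= andbC.
by have [/(fsubsetP AB) ->|] := boolP (x \in A).
Qed.

End FiniteSums.

(** * Hitting probabilities with finite horizon in a finite box *)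

Section Return.
Context (R : realType) (V : countType) (c : V -> V -> R).
Hypothesis c_cond : conductances c.

Definition weight (x : V) : R := fine (total_conductance c x).

Let c0 x y : 0 <= c x y. Proof. by case: c_cond. Qed.

Lemma weightE x : total_conductance c x = (weight x)%:E.
Proof.
rewrite /weight fineK// ge0_fin_numE; first by case: c_cond.
by apply: esum_ge0 => y _; rewrite lee_fin.
Qed.

Lemma weight_ge0 x : 0 <= weight x.
Proof. by rewrite -lee_fin -weightE esum_ge0// => y _; rewrite lee_fin. Qed.

Lemma sum_le_weight x (B : {fset V}) : \sum_(y <- B) c x y <= weight x.
Proof. by rewrite -lee_fin -weightE -sumEFin; exact: sum_fset_le_esum. Qed.

Lemma le_weight x y : c x y <= weight x.
Proof. by have := sum_le_weight x [fset y]%fset; rewrite big_seq_fset1. Qed.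

Definition jump (x y : V) : R := fine (step c x y).

Lemma stepE x y : step c x y = (jump x y)%:E.
Proof. by rewrite /jump /step; case: ifP. Qed.

Lemma weight_jump x y : weight x * jump x y = c x y.
Proof.
rewrite /jump /step weightE eqe; case: ifPn => [/eqP w0|w0] /=; last first.
  by rewrite -/(weight x) mulrC divfK.
by rewrite w0 mul0r; apply/eqP; rewrite eq_le c0 -w0 le_weight.
Qed.

Lemma jump_ge0 x y : 0 <= jump x y.
Proof.
rewrite /jump /step; case: ifP => _ /=; first by rewrite ler0n.
by rewrite divr_ge0// weight_ge0.
Qed.

Lemma sum_jump_le1 x (B : {fset V}) : \sum_(y <- B) jump x y <= 1.
Proof.
have [w0|w0] := eqVneq (weight x) 0; last first.
  have wp : 0 < weight x by rewrite lt0r w0 weight_ge0.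
  rewrite -(ler_pM2l wp) mulr1 mulr_sumr.
  by under eq_bigr do rewrite weight_jump; exact: sum_le_weight.
rewrite /jump /step weightE w0 eqxx /=.
have [xB|xB] := boolP (x \in B).
  rewrite (big_fsetD1 x)//= eqxx big_seq big1 ?addr0// => y.
  by rewrite !inE eq_sym => /andP[/negPf ->].
by rewrite big_seq big1// => y yB; rewrite (_ : _ == _ = false)//; apply: contraNF xB => /eqP ->.
Qed.

Section Target.
Variable v : V.

(* Probability of being at [v] within [m] steps, killed outside [B]. *)
Fixpoint hit (B : {fset V}) (m : nat) (x : V) : R :=
  if x == v then 1 else
  if m is n.+1 then \sum_(y <- B) jump x y * hit B n y else 0.

Lemma hit_target B m : hit B m v = 1.
Proof. by case: m => [|m] /=; rewrite eqxx. Qed.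

Lemma hitS B m x : x != v ->
  hit B m.+1 x = \sum_(y <- B) jump x y * hit B m y.
Proof. by rewrite /= => /negPf ->. Qed.

Lemma hit_itv B m x : 0 <= hit B m x <= 1.
Proof.
elim: m x => [|m IHm] x /=; case: ifP => _; rewrite ?ler01 ?lexx//.
apply/andP; split.
  by apply: sumr_ge0 => y _; rewrite mulr_ge0 ?jump_ge0//; case/andP: (IHm y).
apply: le_trans (sum_jump_le1 x B); apply: ler_sum => y _.
by rewrite ler_piMr ?jump_ge0//; case/andP: (IHm y).
Qed.

Lemma hit_mono B m x : hit B m x <= hit B m.+1 x.
Proof.
elim: m x => [|m IHm] x; have [->|xv] := eqVneq x v; rewrite ?hit_target//.
  by rewrite [leLHS]/= (negPf xv); case/andP: (hit_itv B 1 x).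
by rewrite !hitS//; apply: ler_sum => y _; rewrite ler_wpM2l ?jump_ge0.
Qed.

Lemma first_hit_ge0 n x : (0 <= first_hit c n x v)%E.
Proof.
elim: n x => [|n IHn] x /=; first by rewrite stepE lee_fin jump_ge0.
by apply: esum_ge0 => y _; rewrite stepE mule_ge0// lee_fin jump_ge0.
Qed.

(** The probability of hitting [v] in 1 to [m + 1] steps is a supremum over finite sets of
    trajectories, so every large enough box captures it up to any error. *)
Lemma le_first_hit (m : nat) (x : V) (b : R) :
  (b%:E < \sum_(j < m.+1) first_hit c j x v)%E ->
  exists B0 : {fset V}, forall B : {fset V}, (B0 `<=` B)%fset ->
    b < \sum_(y <- B) jump x y * hit B m y.
Proof.
pose s m x := (\sum_(j < m.+1) first_hit c j x v)%E.
have s0 n z : (0 <= s n z)%E by apply: sume_ge0 => j _; exact: first_hit_ge0.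
have sS n z : s n.+1 z =
    ((jump z v)%:E + \esum_(y in [set y | y != v]) ((jump z y)%:E * s n y))%E.
  rewrite /s big_ord_recl /= stepE; congr (_ + _)%E.
  rewrite -esum_sum => [|y j _ _]; last first.
    by rewrite stepE mule_ge0 ?first_hit_ge0// lee_fin jump_ge0.
  apply: eq_esum => y _; rewrite ge0_sume_distrr => [|j _]; last exact: first_hit_ge0.
  by apply: eq_bigr => j _; rewrite stepE.
have vF (F : {fset V}) : [set` F] `<=` [set y | y != v] -> v \notin F.
  by move=> Fv; apply/negP => /Fv /=; rewrite eqxx.
have s1 n z : (s n z <= 1)%E.
  elim: n z => [|n IHn] z.
    rewrite /s big_ord1 /= stepE lee_fin.
    by have := sum_jump_le1 z [fset v]%fset; rewrite big_seq_fset1.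
  rewrite sS -leeBrDl//; apply: esum_le => F Fv.
  apply: (@le_trans _ _ (\sum_(y <- F) (jump z y)%:E)%E).
    by apply: lee_sum => y _; rewrite -[leRHS]mule1 lee_wpmul2l ?lee_fin ?jump_ge0.
  rewrite sumEFin lee_fin lerBrDl.
  by have := sum_jump_le1 z (v |` F)%fset; rewrite big_fsetU1//= vF.
have sE n z : s n z = (fine (s n z))%:E.
  by rewrite fineK// ge0_fin_numE// (le_lt_trans (s1 n z))// ltry.
rewrite -/(s m x); elim: m x b => [|m IHm] x b.
  rewrite /s big_ord1 /= stepE lte_fin => bv.
  exists [fset v]%fset => B; rewrite fsub1set => vB.
  apply: lt_le_trans bv _; rewrite (big_fsetD1 v)//= eqxx mulr1 lerDl.
  by apply: sumr_ge0 => y _; rewrite mulr_ge0 ?jump_ge0//; case: ifP.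
rewrite sS -lteBlDl// => /lt_esum[F Fv].
under eq_bigr do rewrite sE; rewrite sumEFin lte_fin.
set S := \sum_(y <- F) _ => bS.
(* Half the slack is given up at each first step in [F]; the jump probabilities sum to at most 1, so
   the total loss is at most [gap]. *)
pose gap := (S - (b - jump x v)) / 2.
have gap0 : 0 < gap by rewrite /gap divr_gt0// subr_gt0.
have /choice[G GP] (z : V) : exists B0 : {fset V}, forall B : {fset V},
    (B0 `<=` B)%fset -> fine (s m z) - gap < \sum_(y <- B) jump z y * hit B m y.
  by apply: IHm; rewrite [s m z]sE lte_fin ltrBlDr ltrDl.
exists (v |` F `|` \bigcup_(z <- F) G z)%fset => B.
rewrite !fsubUset fsub1set => /andP[/andP[vB FB] /bigfcupsP GB].
rewrite (big_fsetD1 v)//= eqxx mulr1.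
apply: (@lt_le_trans _ _ (jump x v + \sum_(y <- F) jump x y * (fine (s m y) - gap))).
  under eq_bigr do rewrite mulrBr; rewrite sumrB -/S -mulr_suml.
  have := sum_jump_le1 x F; move: gap0; rewrite /gap; nra.
rewrite lerD2l.
apply: (@le_trans _ _ (\sum_(y <- F) jump x y * hit B m.+1 y)).
  rewrite big_seq [leRHS]big_seq; apply: ler_sum => y yF.
  rewrite ler_wpM2l ?jump_ge0// hitS; last exact: Fv.
  by apply/ltW/GP; exact: GB.
apply: (le_sum_fset (f := fun y => jump x y * hit B m.+1 y)) => [|y].
  apply/fsubsetP => y yF; rewrite !inE (fsubsetP FB)// andbT.
  exact: Fv.
by rewrite mulr_ge0 ?jump_ge0//; case/andP: (hit_itv B m.+1 y).
Qed.

(** Take for [g] the probability of hitting [v] within [m] steps inside [B]. Off [v] it is at most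
    its average after one step, so only [v] contributes positively, namely [weight v] times the
    probability of not returning in time. The sum is the energy of [g] extended by 0 outside [B]. *)
Lemma recurrent_energy (eps : R) : network_recurrent c -> 0 < eps ->
  exists B0 : {fset V}, forall B : {fset V}, (B0 `<=` B)%fset ->
  exists g : V -> R, [/\ g v = 1, forall y, 0 <= g y <= 1 &
    \sum_(x <- B) g x * (weight x * g x - \sum_(y <- B) c x y * g y) <= eps].
Proof.
(* The added 1 covers an isolated [v], whose weight is 0. *)
move=> rec eps0; pose del := eps / (weight v + 1).
have w1 : 0 < weight v + 1 by rewrite ltr_wpDl// weight_ge0.
have del0 : 0 < del by rewrite divr_gt0.
have [m Hm] : exists m, ((1 - del)%:E < \sum_(j < m.+1) first_hit c j v v)%E.
  apply: contrapT => /forallNP H.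
  have : (\sum_(0 <= n <oo) first_hit c n v v <= (1 - del)%:E)%E.
    apply: lime_le.
      by apply: is_cvg_nneseries => n _ _; exact: first_hit_ge0.
    apply: nearW => n; rewrite big_mkord.
    have := H n; move=> /negP; rewrite -leNgt; apply: le_trans.
    by rewrite big_ord_recr /= leeDl// first_hit_ge0.
  by rewrite (rec v) lee_fin; lra.
have [B1 HB1] := le_first_hit Hm.
exists (v |` B1)%fset => B; rewrite fsubUset fsub1set => /andP[vB /HB1 retB].
exists (hit B m); split; [exact: hit_target|exact: hit_itv|].
rewrite (big_fsetD1 v)//= hit_target mul1r mulr1.
set S := \sum_(x <- (B `\ v)%fset) _.
have S0 : S <= 0.
  rewrite /S big_seq; apply: sumr_le0 => x; rewrite !inE => /andP[xv xB].
  rewrite mulr_ge0_le0//; first by case/andP: (hit_itv B m x).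
  rewrite (_ : \sum_(y <- B) c x y * hit B m y = weight x * hit B m.+1 x).
    by rewrite -mulrBr mulr_ge0_le0 ?weight_ge0// subr_le0 hit_mono.
  by rewrite hitS// mulr_sumr; apply: eq_bigr => y _; rewrite mulrA weight_jump.
have -> : \sum_(y <- B) c v y * hit B m y = weight v * \sum_(y <- B) jump v y * hit B m y.
  by rewrite mulr_sumr; apply: eq_bigr => y _; rewrite mulrA weight_jump.
have : eps = (weight v + 1) * del by rewrite /del mulrC divfK// gt_eqF.
have := weight_ge0 v; nra.
Qed.

End Target.
End Return.

(** * Conductances increasing to a limit *)

Lemma lt0_sume (R : realType) (I : eqType) (s : seq I) (f : I -> \bar R) :
  (0 < \sum_(i <- s) f i)%E -> exists i, (0 < f i)%E.
Proof.
move=> s0; apply: contrapT => /forallNP H; move: s0; rewrite ltNge => /negP; apply.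
by apply: sume_le0 => i _; rewrite leNgt; apply/negP.
Qed.

Section MonotoneLimit.
Context (R : realType) (V : countType) (c : R -> V -> V -> R) (cinf : V -> V -> R).
Hypotheses (c_cond : forall t, 0 <= t -> conductances (c t))
  (c_mono : forall s t u v, 0 <= s -> s <= t -> c s u v <= c t u v)
  (c_lim : forall u v, c t u v @[t --> +oo] --> cinf u v)
  (cinf_fin : forall v, (total_conductance cinf v < +oo)%E).

Lemma le_limit s a u v : (forall t, s <= t -> a <= c t u v) -> a <= cinf u v.
Proof.
move=> H; rewrite -(cvg_lim _ (@c_lim u v))//; apply: limr_ge.
  by apply/cvg_ex; exists (cinf u v).
by near=> t; apply: H; near: t; by apply: nbhs_pinfty_ge; rewrite num_real.
Unshelve. all: by end_near. Qed.

Lemma conductance_le_limit t u v : 0 <= t -> c t u v <= cinf u v.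
Proof. by move=> t0; apply: (@le_limit t) => s; exact: c_mono. Qed.

Lemma limit_gt0 u v : 0 < cinf u v -> exists2 t, 0 <= t & 0 < c t u v.
Proof.
move=> uv0; apply: contrapT => /forall2NP H.
suff : cinf u v <= 0 by rewrite leNgt uv0.
rewrite -(cvg_lim _ (@c_lim u v))//; apply: limr_le.
  by apply/cvg_ex; exists (cinf u v).
near=> t; have t0 : 0 <= t by near: t; apply: nbhs_pinfty_ge; rewrite num_real.
by case: (H t) => // /negP; rewrite -leNgt.
Unshelve. all: by end_near. Qed.

Lemma conductances_limit : conductances cinf.
Proof.
have nonneg u v : 0 <= cinf u v.
  by apply: (@le_limit 0) => t /c_cond[].
split=> // [u v|v].
  have E : \forall t \near +oo, c t v u = c t u v.
    near=> t; have t0 : 0 <= t by near: t; apply: nbhs_pinfty_ge; rewrite num_real.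
    by case: (c_cond t0).
  rewrite -(cvg_lim _ (@c_lim u v))//; apply: cvg_lim => //.
  exact: cvg_trans (near_eq_cvg E) (@c_lim v u).
have E : \forall t \near +oo, 0 = c t v v.
  near=> t; have t0 : 0 <= t by near: t; apply: nbhs_pinfty_ge; rewrite num_real.
  by case: (c_cond t0).
rewrite -(cvg_lim _ (@c_lim v v))//; apply: cvg_lim => //.
exact: cvg_trans (near_eq_cvg E) (cvg_cst _).
Unshelve. all: by end_near. Qed.

(** Along a path for the limit network each edge is open from some finite time on and stays open by
    monotonicity; [(p + q)^2 <= 2 p^2 + 2 q^2] adds one edge at a time. *)
Lemma path_energy n x y : (0 < nstep cinf n x y)%E ->
  exists t0 (B0 : {fset V}) C, [/\ 0 <= t0, 0 <= C &
    forall t (B : {fset V}) (u : V -> R), t0 <= t -> (B0 `<=` B)%fset ->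
    (u x - u y) ^+ 2 <= C * \sum_(a <- B) \sum_(b <- B) c t a b * (u a - u b) ^+ 2].
Proof.
elim: n x => [|n IHn] x /=.
  have [->|_] := eqVneq x y; last by rewrite ltxx.
  move=> _; exists 0, fset0, 0; split=> // t B u _ _.
  by rewrite subrr expr0n mul0r.
move=> /lt_esum[F _] /lt0_sume[z].
have n0 : (0 <= nstep cinf n z y)%E.
  elim: n {IHn} z => [|n IHn] z /=; first by rewrite lee_fin ler0n.
  by apply: esum_ge0 => b _; rewrite mule_ge0// stepE lee_fin (jump_ge0 conductances_limit).
rewrite stepE lt0e mule_ge0// ?lee_fin ?(jump_ge0 conductances_limit)// andbT => xzy.
have /IHn[t1 [B1 [C1 [t10 C10 H1]]]] : (0 < nstep cinf n z y)%E.
  by rewrite lt0e n0 andbT; apply: contra xzy => /eqP ->; rewrite mule0.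
have : jump cinf x z != 0 by apply: contra xzy => /eqP ->; rewrite mul0e.
(* At an isolated vertex the only step is to stay put, and the bound for the rest of the path is
   kept. *)
rewrite /jump /step; case: ifP => [_ /=|_ xz].
  have [-> _|_] := eqVneq x z; last by rewrite eqxx.
  by exists t1, B1, C1.
have {xz} /limit_gt0[t2 t20 c0] : 0 < cinf x z.
  rewrite lt0r; case: conductances_limit => _ -> _ _; rewrite andbT.
  by apply: contra xz => /eqP ->; rewrite mul0r.
exists (Num.max t1 t2), (x |` (z |` B1))%fset, (2 * (c t2 x z)^-1 + 2 * C1); split.
- by rewrite le_max t10.
- by rewrite addr_ge0 ?mulr_ge0// invr_ge0 ltW.
move=> t B u; rewrite ge_max !fsubUset !fsub1set => /andP[t1t t2t] /and3P[xB zB B1B].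
have {}H1 := H1 t B u t1t B1B.
have t0 : 0 <= t by apply: le_trans t2t.
have [_ ct0 _ _] := c_cond t0.
have t2z : c t2 x z * (u x - u z) ^+ 2 <=
    \sum_(a <- B) \sum_(b <- B) c t a b * (u a - u b) ^+ 2.
  have T0 a b : 0 <= c t a b * (u a - u b) ^+ 2 by rewrite mulr_ge0 ?sqr_ge0.
  rewrite (big_fsetD1 x)//= (big_fsetD1 z)//= -addrA.
  apply: (@le_trans _ _ (c t x z * (u x - u z) ^+ 2)).
    by rewrite ler_wpM2r ?sqr_ge0// c_mono.
  by rewrite lerDl addr_ge0 ?sumr_ge0// => a _; rewrite sumr_ge0.
rewrite mulrC -ler_pdivlMr// mulrC in t2z.
rewrite mulrDl -!mulrA.
by have := sqr_ge0 (u x - u z - (u z - u y)); rewrite !expr2 in t2z H1 *; nra.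
Qed.

End MonotoneLimit.

Lemma monotone_integral_bounds (R : realType) (f : R -> R) (s t : R) :
  0 <= s -> s <= t -> (forall x y, 0 <= x -> x <= y -> f x <= f y) ->
  f s * (t - s) <= \int[lebesgue_measure]_(r in `]s, t]) f r <= f t * (t - s).
Proof.
move=> s0 st f_mono.
have mI : measurable (`]s, t]%classic : set R) by exact: measurable_itv.
have muI : lebesgue_measure (`]s, t]%classic : set R) = (t - s)%:E.
  by rewrite lebesgue_measure_itv/= lte_fin; case: ltgtP st => // -> _; rewrite subrr.
have finI : (lebesgue_measure (`]s, t]%classic : set R) < +oo)%E by rewrite muI ltry.
have int_cst a : lebesgue_measure.-integrable `]s, t] (EFin \o (fun=> a : R)).
  apply: measurable_bounded_integrable => //.
  exact: bounded_cst.
have int_f : lebesgue_measure.-integrable `]s, t] (EFin \o f).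
  apply: measurable_bounded_integrable => //.
    (* [f] is monotone only on the nonnegative reals; truncating its argument at 0 makes it monotone
       on the whole line, hence measurable. *)
    apply: (@eq_measurable_fun _ _ _ _ `]s, t]%classic (fun r => f (Num.max 0 r))) => [r|].
      rewrite inE/= in_itv/= => /andP[sr _].
      by rewrite max_r// (le_trans s0)// ltW.
    apply: nondecreasing_measurable => //; move=> x y xy; apply: f_mono.
      by rewrite le_max lexx.
    by rewrite ge_max !le_max lexx xy orbT.
  exists (`|f s| + `|f t|); split; first by rewrite num_real.
  move=> M Mb r /=; rewrite in_itv/= => /andP[sr rt]; apply: ltW; apply: le_lt_trans Mb.
  have H1 : f s <= f r by rewrite f_mono// ltW.
  have H2 : f r <= f t by rewrite f_mono// (le_trans s0)// ltW.
  have := ler_norm (f t); have := ler_norm (- f s); rewrite normrN => Hs Ht.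
  have := normr_ge0 (f s); have := normr_ge0 (f t) => Ha Hb.
  by rewrite ler_norml; lra.
have cstE a : a * (t - s) = \int[lebesgue_measure]_(r in `]s, t]) a.
  by rewrite Rintegral_cst//= muI.
rewrite !cstE; apply/andP; split; apply: le_Rintegral => // r;
  rewrite /= in_itv/= => /andP[sr rt].
  by rewrite f_mono// ltW.
by rewrite f_mono// (le_trans s0)// ltW.
Qed.

(** * From clocks to the discretised walk *)

Section Moves.
Context (R : realType) (V : countType) (Omega : Type).
Variables (N : {fset V} -> Omega -> set R) (t : nat -> R).

(* On this event the walk goes from [x] to [y] during ]t_i, t_(i+1)], with at
   most one jump; for [x = y] no edge at [x] rings. *)
Definition moves (i : nat) (x y : V) : set Omega :=
  [set w | forall e : {fset V}, #|` e| = 2%N -> (x \in e) || (y \in e) ->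
    rings (N e) (t i) (t i.+1) (e == [fset x; y]%fset) w].

Lemma no_ring (A : set R) (a b s : R) : ((A `&` `]a, b]) #= `I_0)%card ->
  a < s <= b -> ~ A s.
Proof.
rewrite II0 card_eq0 => /eqP A0 asb As.
by have : (A `&` `]a, b]) s by []; rewrite A0.
Qed.

Lemma one_ring (A : set R) (a b : R) : ((A `&` `]a, b]) #= `I_1)%card ->
  exists s, [/\ a < s <= b, A s & forall s', a < s' <= b -> A s' -> s' = s].
Proof.
move=> /eq_cardSP[s [As]]; rewrite /= in_itv/= => sab.
rewrite II0 card_eq0 => /eqP A0.
exists s; split=> // s' s'ab As'; apply: contrapT => s's.
have : ((A `&` `]a, b]) `\ s) s' by split=> //; split=> //; rewrite /= in_itv.
by rewrite A0.
Qed.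

Lemma card_edge (x y : V) : x != y -> #|` [fset x; y]%fset| = 2%N.
Proof. by move=> xy; rewrite cardfs2 xy. Qed.

Lemma next_ring_ge (Nw : {fset V} -> set R) y a : (a <= next_ring Nw y a)%E.
Proof. by apply/ereal_infP => _ [s [/ltW as_ _] <-]. Qed.

(** The single ring of the edge [xy] carries the walk to [y]; with no other ring at [x] or [y] in
    the window, it neither leaves earlier nor moves on afterwards. *)
Lemma at_vertex_moves (x0 : V) (T : nat -> \bar R) (Y : nat -> V) w i x y :
  t i <= t i.+1 -> follows_clocks (fun e => N e w) x0 T Y ->
  at_vertex T Y (t i) x -> moves i x y w -> at_vertex T Y (t i.+1) y.
Proof.
move=> tt [_ _ T_next Y_next] [n [/andP[Tn tn] Yn]] mv.
have stay m u : Y m = u -> ((t i)%:E < T m.+1)%E ->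
    (forall z s, z != u -> t i < s <= t i.+1 -> N [fset u; z]%fset w s ->
      ~ (T m < s%:E)%E) -> ((t i.+1)%:E < T m.+1)%E.
  move=> Ym tm quiet; rewrite ltNge; apply/negP => mt.
  have mE : T m.+1 = (fine (T m.+1))%:E.
    by rewrite fineK// fin_real// (lt_trans (ltNyr _) tm) (le_lt_trans mt (ltry _)).
  have [ms zu Nz] := Y_next _ _ mE; apply: (quiet (Y m.+1)) ms; rewrite -?Ym//.
  by rewrite -lte_fin -[X in _ && X]lee_fin -mE tm.
have [xy|xy] := eqVneq x y.
  subst y; exists n; split=> //; apply/andP; split; first by rewrite (le_trans Tn).
  apply: (stay n x) => // z s zx st_ Ns.
  (* For [x = y] the set in [moves] is a singleton, so every edge at [x] has prescribed count 0. *)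
  have exz : [fset x; z]%fset != [fset x; x]%fset.
    apply/eqP => /(congr1 (fun e : {fset V} => z \in e)).
    by rewrite !inE eqxx orbT (negPf zx).
  have /mv : #|` [fset x; z]%fset| = 2%N by rewrite card_edge// eq_sym.
  by rewrite !inE eqxx (negPf exz) => /(_ isT) /no_ring /(_ st_).
have := mv [fset x; y]%fset (card_edge xy); rewrite !inE !eqxx => /(_ isT).
move=> /one_ring[s [st_ Ns s_uniq]].
have sT : (T n.+1 <= s%:E)%E.
  rewrite T_next; apply: ereal_inf_lbound; exists s => //; split.
    by rewrite (le_lt_trans Tn)// lte_fin; case/andP: st_.
  by exists y; rewrite ?Yn// eq_sym.
have TE : T n.+1 = (fine (T n.+1))%:E.
  by rewrite fineK// fin_real// (lt_trans (ltNyr _) tn) (le_lt_trans sT (ltry _)).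
have Tin : t i < fine (T n.+1) <= t i.+1.
  rewrite -lte_fin -[X in _ && X]lee_fin -TE tn /= (le_trans sT)// lee_fin.
  by case/andP: st_.
have [_ Yx NY] := Y_next _ _ TE; rewrite Yn in Yx NY.
have Yy : Y n.+1 = y.
  apply/eqP; apply: contrapT => /negP Yy.
  have e_neq : [fset x; Y n.+1]%fset != [fset x; y]%fset.
    apply/eqP => /(congr1 (fun e : {fset V} => Y n.+1 \in e)).
    by rewrite !inE eqxx orbT (negPf Yx) (negPf Yy).
  have /mv : #|` [fset x; Y n.+1]%fset| = 2%N by rewrite card_edge// eq_sym.
  by rewrite !inE eqxx (negPf e_neq) => /(_ isT) /no_ring /(_ Tin).
rewrite Yy in NY; have Ts := s_uniq _ Tin NY.
exists n.+1; split=> //; apply/andP; split.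
  by rewrite TE lee_fin; case/andP: Tin.
apply: (stay n.+1 y) => // [|z s' zy s't Ns'].
  by rewrite (lt_le_trans tn)// (T_next n.+1) next_ring_ge.
(* The edge just used rings once in the window, at the jump time itself, so it cannot ring strictly
   later. *)
have [e_eq|e_neq] := eqVneq [fset y; z]%fset [fset x; y]%fset.
  by rewrite e_eq in Ns'; rewrite (s_uniq _ s't Ns') TE Ts ltxx.
have /mv : #|` [fset y; z]%fset| = 2%N by rewrite card_edge// eq_sym.
by rewrite !inE eqxx orbT (negPf e_neq) => /(_ isT) /no_ring /(_ s't).
Qed.

Lemma at_vertex_start (x0 : V) (T : nat -> \bar R) (Y : nat -> V) w :
  follows_clocks (fun e => N e w) x0 T Y -> at_vertex T Y 0 x0.
Proof.
move=> [T0 Y0 T_next Y_next]; exists 0%N; split=> //; rewrite T0 lexx /=.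
have : (0 <= T 1%N)%E by rewrite (T_next 0%N) T0 next_ring_ge.
rewrite le_eqVlt => /predU1P[/esym/Y_next[]|//].
by rewrite T0 ltxx.
Qed.

End Moves.

(** * Probabilities of prescribed numbers of rings on the grid *)

Section Clocks.
Context (R : realType) (V : countType) (d : measure_display)
  (Omega : measurableType d) (P : probability Omega R).
Context (c : R -> V -> V -> R) (N : {fset V} -> Omega -> set R) (t : nat -> R).
Hypotheses (clocks : independent_clocks P c N) (t0 : 0 <= t 0%N)
  (t_mono : {homo t : i j / (i <= j)%N >-> i <= j}).
Implicit Types (e : {fset V}) (watched : nat -> {fset V} -> bool)
  (count : nat -> {fset V} -> nat).

Let t_ge0 i : 0 <= t i. Proof. by apply: le_trans (t_mono (leq0n i)). Qed.

Let t_le i : t i <= t i.+1. Proof. exact: t_mono. Qed.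

Lemma edgeP e x : #|` e| = 2%N -> x \in e -> exists2 z : V, z != x & e = [fset x; z]%fset.
Proof.
move=> e2 xe; move: e2; rewrite (cardfsD1 x) xe add1n => -[] /eqP /cardfs1P[z ez].
exists z; last by rewrite -ez fsetD1K.
have : z \in (e `\ x)%fset by rewrite ez !inE.
by rewrite !inE => /andP[].
Qed.

Lemma poisson_edge e : #|` e| = 2%N ->
  exists u v, [/\ u != v, e = [fset u; v]%fset & poisson_clock P (N e) (fun t => c t u v)].
Proof.
move=> e2; have : (0 < #|` e|)%N by rewrite e2.
rewrite cardfs_gt0 => /fset0Pn[u ue].
have [v vu ->] := edgeP e2 ue; exists u, v; split=> //; first by rewrite eq_sym.
by case: clocks => + _; apply; rewrite eq_sym.
Qed.

Lemma measurable_rings e i k : #|` e| = 2%N ->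
  measurable (rings (N e) (t i) (t i.+1) k).
Proof. by move=> /poisson_edge[u [v [_ _ [+ _ _]]]]; apply. Qed.

Definition edges (n : nat) : {fset {fset V}} :=
  [fset e : {fset V} in pmap (@choice.unpickle {fset V}) (iota 0 n) | #|` e| == 2%N]%fset.

Lemma edges_card n e : e \in edges n -> #|` e| = 2%N.
Proof. by rewrite !inE /= => /andP[_ /eqP]. Qed.

Lemma mem_edges n e : #|` e| = 2%N -> (choice.pickle e < n)%N -> e \in edges n.
Proof.
move=> e2 en; rewrite !inE /= e2 eqxx andbT mem_pmap; apply/mapP.
by exists (choice.pickle e); rewrite ?mem_iota// choice.pickleK.
Qed.

Lemma edges_mono n n' : (n <= n')%N -> (edges n `<=` edges n')%fset.
Proof.
move=> nn'; apply/fsubsetP => e; rewrite !inE /= => /andP[+ ->]; rewrite andbT.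
rewrite !mem_pmap => /mapP[k]; rewrite mem_iota => /andP[_ kn] kE.
by apply/mapP; exists k => //; rewrite mem_iota /=; apply: leq_trans nn'.
Qed.

(* [watched j e] tells whether the number of rings of [e] in ]t_j, t_(j+1)] is
   prescribed, and [count j e] is the prescribed number. *)
Definition history (F : {fset {fset V}}) watched count (i : nat) : set Omega :=
  \bigcap_(e in [set` F]) \bigcap_(j in [set` [fset j in iota 0 i | watched j e]%fset])
    rings (N e) (t j) (t j.+1) (count j e).

Lemma prob_history F watched count i : {in F, forall e, #|` e| = 2%N} ->
  P (history F watched count i) =
  (\prod_(e <- F) \prod_(j < i | watched j e)
    P (rings (N e) (t j) (t j.+1) (count j e)))%E.
Proof.
move=> F2; have [Hp Hi] := clocks.
rewrite /history Hi => [|e eF].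
  rewrite big_seq [RHS]big_seq; apply: eq_bigr => e eF.
  have [u [v [uv eE [_ _ Hind]]]] := poisson_edge (F2 e eF).
  rewrite (Hind t t0 t_mono) => [|j _]; last by split=> //; exists (count j e).
  rewrite -(big_mkord (fun j => watched j e)
    (fun j => P (rings (N e) (t j) (t j.+1) (count j e)))).
  rewrite /index_iota subn0 -[RHS]big_filter; apply: perm_big.
  apply: uniq_perm; rewrite ?filter_uniq ?iota_uniq ?fset_uniq// => j.
  by rewrite mem_filter !inE /= andbC.
split; first exact: F2.
apply: (@fin_bigcap_measurable _ (g_sigma_algebraType
  [set A | exists s t k, [/\ 0 <= s, s <= t & A = rings (N e) s t k] ])) => // j _.
by apply: sub_sigma_algebra; exists (t j), (t j.+1), (count j e).
Qed.

Definition intensity (i : nat) (u v : V) : R :=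
  \int[lebesgue_measure]_(r in `]t i, t i.+1]) c r u v.

(* Read off from the probability of no ring, because the clock of [e] has its rate
   given in terms of an ordering of the endpoints of [e]. *)
Definition edge_intensity (i : nat) e : R :=
  - ln (fine (P (rings (N e) (t i) (t i.+1) 0))).

Lemma edge_intensityE i u v : u != v ->
  edge_intensity i [fset u; v]%fset = intensity i u v.
Proof.
case: clocks => H _ /H[_ law _]; rewrite /edge_intensity law//.
by rewrite expr0 fact0 divr1 mul1r /= expRK opprK.
Qed.

Lemma edge_intensity_ge0 i e : #|` e| = 2%N -> 0 <= edge_intensity i e.
Proof.
move=> e2; rewrite oppr_ge0 ln_le0// -lee_fin fineK ?fin_num_measure ?probability_le1//;
  exact: measurable_rings.
Qed.

Lemma prob_rings i e (b : bool) : #|` e| = 2%N ->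
  P (rings (N e) (t i) (t i.+1) b) =
  ((if b then edge_intensity i e else 1) * expR (- edge_intensity i e))%:E.
Proof.
move=> /poisson_edge[u [v [uv eE]]]; rewrite eE edge_intensityE// => -[_ law _].
by rewrite law//; case: b; rewrite ?expr1 ?fact1 ?expr0 ?fact0 divr1.
Qed.

(** Edges at [x] correspond one to one to their other endpoints, which turns sums over edges into
    sums over neighbours. *)
Lemma sum_star i (F : {fset {fset V}}) x : {in F, forall e, #|` e| = 2%N} ->
  exists2 Z : {fset V}, x \notin Z &
  \sum_(e <- F | x \in e) edge_intensity i e = \sum_(z <- Z) intensity i x z.
Proof.
move=> F2; pose Z := [fset z in (\bigcup_(e <- F) e)%fset |
  (z != x) && ([fset x; z]%fset \in F)]%fset.
exists Z; first by rewrite !inE /= eqxx andbF.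
have ZE : [fset e in F | x \in e]%fset = [fset [fset x; z]%fset | z in Z]%fset.
  apply/fsetP => e; rewrite !inE /=; apply/idP/imfsetP => [/andP[eF xe]|[z]].
    have [z zx eE] := edgeP (F2 e eF) xe; exists z => //=.
    rewrite !inE /= zx -eE eF /= andbT.
    have : z \in (\bigcup_(e0 <- F) e0)%fset.
      by apply/bigfcupP; exists e; rewrite ?eF// eE !inE eqxx orbT.
    by [].
  by rewrite !inE /= => /and3P[_ _ eF] ->; rewrite eF !inE eqxx.
rewrite big_fset_condE ZE big_imfset /=; last first.
  move=> z z'; rewrite !inE /= => /and3P[_ zx _] /and3P[_ z'x _] E.
  have : z \in [fset x; z']%fset by rewrite -E !inE eqxx orbT.
  by rewrite !inE (negPf zx) => /eqP.
rewrite big_seq [RHS]big_seq; apply: eq_bigr => z.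
by rewrite !inE /= => /and3P[_ zx _]; rewrite edge_intensityE// eq_sym.
Qed.

Definition past watched count (i : nat) : set Omega :=
  \bigcap_n history (edges n) watched count i.

Lemma measurable_history n watched count i :
  measurable (history (edges n) watched count i).
Proof.
apply: fin_bigcap_measurable => // e /edges_card e2.
by apply: fin_bigcap_measurable => // j _; exact: measurable_rings.
Qed.

Lemma measurable_past watched count i : measurable (past watched count i).
Proof. by apply: bigcap_measurable => // n _; exact: measurable_history. Qed.

Lemma pastP watched count i w : past watched count i w <->
  forall j e, (j < i)%N -> #|` e| = 2%N -> watched j e ->
    rings (N e) (t j) (t j.+1) (count j e) w.
Proof.
split=> [H j e ji e2 we|H n _ e /= /edges_card e2 j].
  apply: (H (choice.pickle e).+1 I e) => /=; first exact: mem_edges.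
  by rewrite !inE /= mem_iota ji.
by rewrite /= !inE /= mem_iota => /andP[/andP[_ ji] we]; exact: H.
Qed.

Definition extend_watched watched i x y j e :=
  if j == i then (x \in e) || (y \in e) else watched j e.

Definition extend_count count i x y j e : nat :=
  if j == i then nat_of_bool (e == [fset x; y]%fset) else count j e.

(** Prescriptions are closed under one more move. This replaces conditioning on the trajectory:
    estimates proved for every [past] can be iterated. *)
Lemma past_moves watched count i x y :
  past watched count i `&` moves N t i x y =
  past (extend_watched watched i x y) (extend_count count i x y) i.+1.
Proof.
apply/seteqP; split=> w.
  move=> [/pastP H mv]; apply/pastP => j e; rewrite /extend_watched /extend_count.
  rewrite ltnS leq_eqVlt; case: eqVneq => [-> _ e2 xy|ji /= ji' e2 we].
    exact: mv.
  exact: H.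
move=> /pastP H; split.
  apply/pastP => j e ji e2 we; have := H j e (leqW ji) e2.
  by rewrite /extend_watched /extend_count ltn_eqF//; apply.
move=> e e2 xy; have := H i e (leqnn _) e2.
by rewrite /extend_watched /extend_count eqxx; apply.
Qed.

Lemma measurable_moves i x y : measurable (moves N t i x y).
Proof.
have -> : moves N t i x y = past (fun=> fun=> false) (fun=> fun=> 0%N) i `&` moves N t i x y.
  by rewrite setIC; apply/esym/setIidPl => w _; apply/pastP.
by rewrite past_moves; exact: measurable_past.
Qed.

(** A vertex may have infinitely many edges, so the event is the decreasing limit of its
    restrictions to [edges n]. For each [n] independence splits off the factor of window [i], and
    [q] bounds these factors uniformly in [n]. *)
Lemma prob_past_moves_ge watched count i x y (q : R) :
  0 <= q ->
  (forall n, q <= (if [fset x; y]%fset \in edges n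
                   then edge_intensity i [fset x; y]%fset else 1)
     * (1 - \sum_(e <- edges n | (x \in e) || (y \in e)) edge_intensity i e)) ->
  (P (past watched count i) * q%:E <= P (past watched count i `&` moves N t i x y))%E.
Proof.
move=> q0 qn; rewrite past_moves.
set W := extend_watched _ _ _ _; set K := extend_count _ _ _ _.
have cvgP : (P \o (fun n => history (edges n) W K i.+1)) n @[n --> \oo] -->
    P (past W K i.+1).
  apply: nonincreasing_cvg_mu.
  - by rewrite (le_lt_trans (probability_le1 _ _)) ?ltry//; exact: measurable_history.
  - by move=> n; exact: measurable_history.
  - exact: measurable_past.
  - move=> n n' nn'; apply/subsetPset => w H e en; apply: H => /=.
    exact: (fsubsetP (edges_mono nn')).
rewrite -(cvg_lim _ cvgP)//; apply: lime_ge; first by apply/cvg_ex; eexists; exact: cvgP.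
apply: nearW => n /=.
have E2 : {in edges n, forall e, #|` e| = 2%N} by move=> e; exact: edges_card.
have -> : P (history (edges n) W K i.+1) = (P (history (edges n) watched count i) *
    \prod_(e <- edges n | (x \in e) || (y \in e))
      P (rings (N e) (t i) (t i.+1) (e == [fset x; y]%fset)))%E.
  rewrite !prob_history// [X in (_ * X)%E]big_mkcond -big_split /=.
  apply: eq_bigr => e _; rewrite big_mkcond big_ord_recr /= -big_mkcond.
  rewrite /W /K /extend_watched /extend_count eqxx; congr (_ * _)%E.
  rewrite big_mkcond [RHS]big_mkcond; apply: eq_bigr => j _.
  by rewrite ltn_eqF.
apply: lee_pmul => //.
  apply: le_measure; rewrite ?inE//; last exact: bigcap_inf.
    exact: measurable_past.
  exact: measurable_history.
rewrite big_seq_cond.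
under eq_bigr => e /andP[/edges_card e2 _] do rewrite prob_rings//.
rewrite -big_seq_cond prodEFin lee_fin; apply: le_trans (qn n) _.
rewrite big_split /=.
have -> : \prod_(e <- edges n | (x \in e) || (y \in e))
   (if e == [fset x; y]%fset then edge_intensity i e else 1) =
   if [fset x; y]%fset \in edges n then edge_intensity i [fset x; y]%fset else 1.
  rewrite big_mkcond /=; case: ifPn => [xyn|xyn].
    rewrite (big_fsetD1 [fset x; y]%fset)//= !inE !eqxx big_seq big1 ?mulr1// => e.
    by rewrite !inE => /andP[/negPf -> _]; case: ifP.
  rewrite big_seq big1// => e en; case: ifP => // _; case: eqP => // eE.
  by rewrite -eE en in xyn.
apply: ler_wpM2l.
  by case: ifP => [/edges_card /edge_intensity_ge0|].
(* The factors [expR (- I_e)] multiply to the exponential of minus the sum, which is at least 1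
   minus the sum. *)
rewrite -expR_sum [X in expR X]sumrN.
exact: expR_ge1Dx.
Qed.

(** * The discretised killed walk in a finite box *)

Section Box.
Context (cinf : V -> V -> R) (B : {fset V}) (eta K : R).
Hypotheses (cinf_cond : conductances cinf)
  (intensity_sym : forall i x y, intensity i x y = intensity i y x)
  (intensity_bound : forall i x y, 0 <= intensity i x y <= eta * cinf x y)
  (eta_gt0 : 0 < eta) (K_ge : {in B, forall x, 2 * weight cinf x <= K})
  (K_small : 4 * (K * eta) <= 1) (K_ge0 : 0 <= K).

(* The factor [1 - K * eta] bounds below the probability that no other edge at [x]
   or [y] rings during the same step. *)
Definition box_rate (i : nat) (x y : V) : R := (1 - K * eta) * intensity i x y.

(* Intensity of leaving the box, plus an allowance for two rings in one step. *)
Definition box_killing (x : V) : R :=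
  eta * (weight cinf x - \sum_(y <- B) cinf x y + K ^+ 2 * eta).

(** The substochastic kernel, identity minus Laplacian, whose action on functions is one unstopped
    backward step. *)
Definition box_step (i : nat) (x y : V) : R :=
  (x == y)%:R * (1 - \sum_(z <- B) box_rate i x z - box_killing x) + box_rate i x y.

Let Keta0 : 0 <= K * eta. Proof. by rewrite mulr_ge0// ltW. Qed.

Lemma box_rate_sym i x y : box_rate i x y = box_rate i y x.
Proof. by rewrite /box_rate intensity_sym. Qed.

Lemma box_rate_ge0 i x y : 0 <= box_rate i x y.
Proof.
rewrite mulr_ge0//; last by case/andP: (intensity_bound i x y).
by move: Keta0 K_small; lra.
Qed.

Lemma box_killing_ge0 x : 0 <= box_killing x.
Proof.
rewrite mulr_ge0 ?(ltW eta_gt0)// addr_ge0 ?subr_ge0 ?sum_le_weight//.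
by rewrite mulr_ge0 ?sqr_ge0// ltW.
Qed.

Lemma sum_intensity_le i x (Z : {fset V}) :
  \sum_(z <- Z) intensity i x z <= eta * weight cinf x.
Proof.
apply: (@le_trans _ _ (\sum_(z <- Z) eta * cinf x z)).
  by apply: ler_sum => z _; case/andP: (intensity_bound i x z).
by rewrite -mulr_sumr ler_wpM2l ?sum_le_weight// ltW.
Qed.

Lemma box_half i : {in B, forall x, \sum_(y <- B) box_rate i x y + box_killing x <= 2^-1}.
Proof.
have Keta := Keta0; have Ksm := K_small; have eta0 := eta_gt0.
 move=> x xB; rewrite -mulr_sumr /box_killing.
have S0 : 0 <= \sum_(y <- B) intensity i x y.
  by apply: sumr_ge0 => y _; case/andP: (intensity_bound i x y).
have C0 : 0 <= \sum_(y <- B) cinf x y by apply: sumr_ge0 => y _; case: cinf_cond.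
have := sum_intensity_le i x B; have := K_ge xB; have := weight_ge0 cinf_cond x.
move: (\sum_(y <- B) _) S0 => S S0; move: (\sum_(y <- B) _) C0 => C C0.
move: (weight _ _) => w w0 wK Sw; rewrite mulrDr mulrBr.
have H1 : eta * w <= K * eta / 2 by nra.
have H2 : (1 - K * eta) * S <= S by nra.
have H3 : 0 <= eta * C by rewrite mulr_ge0// ltW.
have -> : eta * (K ^+ 2 * eta) = (K * eta) * (K * eta) by ring.
have : (K * eta) * (K * eta) <= 4^-1 * 4^-1 by apply: ler_pM => //; lra.
lra.
Qed.

Lemma intensity_diag i x : intensity i x x = 0.
Proof.
apply/eqP; rewrite eq_le; have /andP[-> ] := intensity_bound i x x.
by case: cinf_cond => _ _ -> _; rewrite mulr0 => ->.
Qed.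

Lemma box_step_ge0 i x y : x \in B -> 0 <= box_step i x y.
Proof.
move=> xB; rewrite addr_ge0 ?box_rate_ge0// mulr_ge0 ?ler0n//.
by have := box_half i xB; lra.
Qed.

Lemma backward_box i u x : x \in B ->
  backward B (box_rate i) box_killing pred0 u x = \sum_(y <- B) box_step i x y * u y.
Proof.
move=> xB; rewrite /backward /= /laplacian /box_step.
under [RHS]eq_bigr do rewrite mulrDl; rewrite big_split /=.
have -> q : \sum_(y <- B) (x == y)%:R * q * u y = q * u x.
  rewrite (big_fsetD1 x)//= eqxx mul1r big_seq big1 ?addr0// => y.
  by rewrite !inE eq_sym => /andP[/negPf -> _]; rewrite !mul0r.
under eq_bigr do rewrite mulrBr.
by rewrite sumrB -mulr_suml; ring.
Qed.

(** The true step dominates the killed kernel whatever the past: for [x != y], other rings at [x] or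
    [y] cost at most [K * eta]; for [x = y], the killing pays for edges leaving [B] and for the
    reduction of the rates. *)
Lemma prob_step watched count i x y : x \in B -> y \in B ->
  (P (past watched count i) * (box_step i x y)%:E <=
   P (past watched count i `&` moves N t i x y))%E.
Proof.
have Keta := Keta0; have Ksm := K_small; have eta0 := eta_gt0.
move=> xB yB; apply: prob_past_moves_ge => [|n]; first exact: box_step_ge0.
have E2 : {in edges n, forall e, #|` e| = 2%N} by move=> e; exact: edges_card.
rewrite /box_step; have [->|xy] := eqVneq x y.
  rewrite ifF; last first.
    by apply/negbTE/negP => /edges_card; rewrite cardfs2 eqxx.
  rewrite !mul1r (eq_bigl (fun e : {fset V} => y \in e)) => [|e]; last by rewrite orbb.
  have [Z _ ->] := sum_star i y E2.
  rewrite [box_rate i y y]/box_rate intensity_diag mulr0 addr0 -addrA -opprD lerD2l lerN2.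
  (* Edges to [Z] outside [B] are charged at the limit conductance, whose total outside [B] is
     [weight cinf y] minus the sum over [B]. *)
  have H : \sum_(z <- Z) intensity i y z <= \sum_(z <- B) intensity i y z +
      eta * (weight cinf y - \sum_(z <- B) cinf y z).
    have f0 z : 0 <= eta * cinf y z - intensity i y z.
      by rewrite subr_ge0; case/andP: (intensity_bound i y z).
    have := le_sum_fset (fsubsetUl B Z) f0; rewrite !sumrB -!mulr_sumr.
    have := sum_le_weight cinf_cond y (B `|` Z)%fset.
    move=> /(ler_wpM2l (ltW eta_gt0)).
    have : \sum_(z <- Z) intensity i y z <= \sum_(z <- (B `|` Z)%fset) intensity i y z.
      by apply: le_sum_fset (fsubsetUr B Z) _ => z; case/andP: (intensity_bound i y z).
    lra.
  have SB : \sum_(z <- B) intensity i y z <= K * eta.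
    apply: le_trans (sum_intensity_le i y B) _; rewrite mulrC ler_wpM2r ?(ltW eta_gt0)//.
    by have := K_ge yB; have := weight_ge0 cinf_cond y; lra.
  have := ler_wpM2l Keta0 SB; rewrite -mulr_sumr /box_killing; move: H.
  lra.
rewrite mul0r add0r.
have [Zx _ Ex] := sum_star i x E2; have [Zy _ Ey] := sum_star i y E2.
have S : \sum_(e <- edges n | (x \in e) || (y \in e)) edge_intensity i e <= K * eta.
  apply: (@le_trans _ _ (\sum_(e <- edges n | x \in e) edge_intensity i e +
    \sum_(e <- edges n | y \in e) edge_intensity i e)).
    rewrite big_mkcond [X in _ <= X + _]big_mkcond [X in _ <= _ + X]big_mkcond -big_split.
    rewrite big_seq [leRHS]big_seq; apply: ler_sum => e /edges_card/(edge_intensity_ge0 i) e0.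
    by case: (x \in e); case: (y \in e); rewrite /= ?addr0 ?add0r ?lerDl.
  rewrite Ex Ey; have := sum_intensity_le i x Zx; have := sum_intensity_le i y Zy.
  have := ler_wpM2r (ltW eta_gt0) (K_ge xB); have := ler_wpM2r (ltW eta_gt0) (K_ge yB).
  lra.
rewrite edge_intensityE// /box_rate.
have /andP[I0 I1] := intensity_bound i x y.
(* While [edges n] does not yet contain the edge [xy], its factor is 1 in place of its intensity. *)
have I2 : intensity i x y <= 1.
  have := ler_wpM2l (ltW eta_gt0) (le_weight cinf_cond x y).
  have := ler_wpM2r (ltW eta_gt0) (K_ge xB).
  have := mulr_ge0 (ltW eta_gt0) (weight_ge0 cinf_cond x); lra.
case: ifP => _; last first.
  by rewrite mul1r; apply: le_trans (_ : 1 - K * eta <= _); [rewrite ler_piMr//|]; lra.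
by rewrite mulrC ler_wpM2l//; lra.
Qed.

Section Reach.
Variables (v : V) (M : nat).

(* Being at [v] at one of the steps [i, ..., i + j] that is at least [M], coming
   from [x] at step [i]. *)
Fixpoint reach (j i : nat) (x : V) : set Omega :=
  if (M <= i)%N && (x == v) then [set: Omega] else
  if j is j'.+1 then
    \big[setU/set0]_(y <- B) (moves N t i x y `&` reach j' i.+1 y)
  else set0.

Lemma measurable_reach j i x : measurable (reach j i x).
Proof.
elim: j i x => [|j IHj] i x /=; case: ifP => // _.
by apply: bigsetU_measurable => y _; apply: measurableI; first exact: measurable_moves.
Qed.

Lemma moves_disjoint i x : trivIset [set: V] (moves N t i x).
Proof.
move=> y y' _ _ [w [xy xy']].
have distinct z z' : z != z' -> z != x -> moves N t i x z w -> moves N t i x z' w -> False.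
  move=> zz' zx mz mz'.
  have exz : #|` [fset x; z]%fset| = 2%N by rewrite card_edge// eq_sym.
  have := mz _ exz; have := mz' _ exz; rewrite !inE !eqxx /=.
  have -> : ([fset x; z] == [fset x; z'])%fset = false.
    apply/negP => /eqP/(congr1 (fun e : {fset V} => z \in e)).
    by rewrite !inE eqxx orbT (negPf zz') (negPf zx).
  move=> /(_ isT) /no_ring no_s /(_ isT) /one_ring[s [st_ Ns _]].
  exact: no_s st_ Ns.
apply/eqP; apply: contrapT => /negP yy'.
(* Of two different targets at least one is not [x]; its edge to [x] rings once for that target and
   not at all for the other. *)
have [yx|yx] := eqVneq y x; last exact: (distinct y y').
apply: (distinct y' y) => //; first by rewrite eq_sym.
by rewrite -yx eq_sym.
Qed.

(** Induction on the remaining steps, for all pasts at once: moves to different [y] are disjoint, so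
    their lower bounds add up to the backward equation. Nonnegativity of [u] is carried along to
    multiply inequalities. *)
Lemma prob_reach (u : nat -> V -> R) m :
  (M <= m)%N ->
  u m = (fun x => (x == v)%:R) ->
  (forall i, (i < m)%N -> u i =
    backward B (box_rate i) box_killing (fun x => (M <= i)%N && (x == v)) (u i.+1)) ->
  forall j i x watched count, (i + j = m)%N -> x \in B ->
  0 <= u i x /\ 
  (P (past watched count i) * (u i x)%:E <= P (past watched count i `&` reach j i x))%E.
Proof.
move=> Mm um u_eq; elim=> [|j IHj] i x watched count.
  rewrite addn0 => -> xB; rewrite um ler0n; split=> //=.
  by rewrite Mm /=; case: eqP => _; rewrite ?setIT ?mule1// setI0 mule0 measure0.
move=> ijm xB; have im : (i < m)%N by rewrite -ijm -addn1 leq_add2l.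
rewrite u_eq// /=; case: ifPn => [/andP[Mi /eqP ->]|nst].
  rewrite -u_eq// (backward_stop u_eq); [|exact: ltnW|]; last first.
    by move=> l /andP[il _]; rewrite eqxx (leq_trans Mi il).
  by rewrite um eqxx ler01 setIT mule1.
have -> : backward B (box_rate i) box_killing (fun x => (M <= i)%N && (x == v)) (u i.+1) x
    = \sum_(y <- B) box_step i x y * u i.+1 y.
  by rewrite -backward_box// /backward (negPf nst).
have {}IHj y w' k' yB := IHj i.+1 y w' k' (etrans (addSnnS _ _) ijm) yB.
split.
  rewrite big_seq; apply: sumr_ge0 => y yB.
  by have [u0 _] := IHj y watched count yB; rewrite mulr_ge0// box_step_ge0.
rewrite big_distrr /= measure_fbigsetU => [|y _|]; last first.
- apply: sub_trivIset (subsetT _) _ => y y' _ _ [w [[_ [mv _]] [_ [mv' _]]]].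
  by apply: (@moves_disjoint i x y y') => //; exists w.
- apply: measurableI; first exact: measurable_past.
  by apply: measurableI; [exact: measurable_moves|exact: measurable_reach].
rewrite -sumEFin big_seq ge0_sume_distrr => [|y yB]; last first.
  by have [u0 _] := IHj y watched count yB; rewrite lee_fin mulr_ge0// box_step_ge0.
rewrite [leRHS]big_seq; apply: lee_sum => y yB.
rewrite setIA past_moves.
have [u0] := IHj y (extend_watched watched i x y) (extend_count count i x y) yB.
apply: le_trans; rewrite EFinM muleA lee_wpmul2r ?lee_fin// -past_moves.
exact: prob_step.
Qed.

Lemma reach_visit (x0 : V) (T : nat -> \bar R) (Y : nat -> V) w j i x :
  follows_clocks (fun e => N e w) x0 T Y -> reach j i x w ->
  at_vertex T Y (t i) x -> exists2 l, (M <= l)%N & at_vertex T Y (t l) v.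
Proof.
move=> fw; elim: j i x => [|j IHj] i x /=.
  by case: ifP => [/andP[Mi /eqP ->] _|_ //]; exists i.
case: ifP => [/andP[Mi /eqP ->] _|_]; first by exists i.
rewrite -bigcup_seq => -[y _ [mv ry]] ati; apply: IHj ry _.
exact: at_vertex_moves fw ati mv.
Qed.

End Reach.
End Box.
End Clocks.

(** * Late visits *)

Section LateVisit.
Context (R : realType) (V : countType) (c : R -> V -> V -> R) (cinf : V -> V -> R).
Hypotheses (c_cond : forall t, 0 <= t -> conductances (c t))
  (c_mono : forall s t u v, 0 <= s -> s <= t -> c s u v <= c t u v)
  (c_lim : forall u v, c t u v @[t --> +oo] --> cinf u v)
  (cinf_fin : forall v, (total_conductance cinf v < +oo)%E)
  (cinf_irr : network_irreducible cinf)
  (cinf_rec : network_recurrent cinf).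
Context (d : measure_display) (Omega : measurableType d) (P : probability Omega R).
Context (N : {fset V} -> Omega -> set R).
Hypothesis clocks : independent_clocks P c N.

Let cinf_cond : conductances cinf := conductances_limit c_cond c_lim cinf_fin.

(** The upper bound in window [i] is the lower bound in window [i + 1], so the intensities inherit
    monotonicity in time. *)
Lemma grid_intensity (eta : R) i u v : 0 <= eta ->
  eta * c (i%:R * eta) u v <= intensity c (fun i => i%:R * eta) i u v
    <= eta * c (i.+1%:R * eta) u v.
Proof.
move=> eta0; rewrite /intensity.
have i0 : 0 <= i%:R * eta by rewrite mulr_ge0.
have ii : i%:R * eta <= i.+1%:R * eta by rewrite ler_wpM2r// ler_nat.
have := monotone_integral_bounds (f := fun r => c r u v) i0 ii
  (fun x y x0 xy => c_mono u v x0 xy).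
by rewrite -mulrBl -natr1 addrAC subrr add0r mul1r ![eta * _]mulrC.
Qed.

Lemma grid_intensity_sym (eta : R) i u v : 0 <= eta ->
  intensity c (fun i => i%:R * eta) i u v = intensity c (fun i => i%:R * eta) i v u.
Proof.
move=> eta0; apply: eq_Rintegral => r; rewrite inE /= in_itv /= => /andP[ir _].
have r0 : 0 <= r by apply: le_trans (ltW ir); rewrite mulr_ge0.
by case: (c_cond r0).
Qed.

(** Killing at the rate of leaving [B] turns the energy inside the box into that of [g] extended by
    0; the two-ring allowance adds at most [K^2 * eta] per vertex, up to the factor [eta]. *)
Lemma terminal_energy (B : {fset V}) (eta K : R) (a : V -> V -> R) (g : V -> R) :
  0 <= eta -> (forall x y, a x y <= eta * cinf x y) ->
  (forall y, 0 <= g y <= 1) ->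
  dirichlet B a (box_killing cinf B eta K) g g <=
  eta * (\sum_(x <- B) g x * (weight cinf x * g x - \sum_(y <- B) cinf x y * g y)
     + K ^+ 2 * eta * (size B)%:R).
Proof.
move=> eta0 ac g01.
apply: le_trans (le_dirichlet (a' := fun x y => eta * cinf x y)
  (k' := box_killing cinf B eta K) g ac _) _ => //.
rewrite -sum_laplacian; last by move=> x y; case: cinf_cond => ->.
rewrite -sum1_size natr_sum mulrDr !mulr_sumr -big_split /=.
apply: ler_sum => x _; rewrite /laplacian /box_killing.
have -> : \sum_(y <- B) eta * cinf x y * (g x - g y) =
    eta * (g x * (\sum_(y <- B) cinf x y) - \sum_(y <- B) cinf x y * g y).
  by rewrite !mulr_sumr -sumrB mulr_sumr; apply: eq_bigr => y _; ring.
have g2 : g x ^+ 2 <= 1 by rewrite expr_le1//; case/andP: (g01 x).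
set w := weight _ _; set S := \sum_(y <- B) cinf x y; set G := \sum_(y <- B) _ * _.
have c0 : 0 <= eta * (K ^+ 2 * eta) by rewrite mulr_ge0// mulr_ge0// sqr_ge0.
have H := ler_wpM2l c0 g2; rewrite -subr_ge0 in H; rewrite -subr_ge0.
by apply: le_trans H _; rewrite le_eqVlt; apply/orP; left; apply/eqP; ring.
Qed.

(** [s0] is a time by which a path from [x0] to [v] is open. [H] depends on the clocks alone, hence
    serves every [T] and [Y] that follow them. *)
Lemma late_visit (x0 v : V) : exists2 s0, 0 <= s0 &
  forall s del, s0 < s -> 0 < del ->
  exists H : set Omega, [/\ measurable H, ((1 - del)%:E <= P H)%E &
    forall w T Y, H w -> follows_clocks (fun e => N e w) x0 T Y ->
      exists2 r, s <= r & at_vertex T Y r v].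
Proof.
have [n /(path_energy c_cond c_mono c_lim cinf_fin)] := cinf_irr x0 v.
move=> [s0 [B1 [C [s00 C0 path]]]]; exists s0 => // s del s0s del0.
have sgt0 : 0 < s by exact: le_lt_trans s0s.
(* Both [4 * C * theta], for the path to [v] at time [s], and [s * theta], for the drift on [0, s],
   are then at most [(del / 2)^2]. *)
pose theta := (del / 2) ^+ 2 / (4 * C + s).
have CS0 : 0 < 4 * C + s by rewrite ltr_wpDl// mulr_ge0.
have theta0 : 0 < theta by rewrite divr_gt0// exprn_gt0// divr_gt0.
(* Three errors of at most [theta / 6] each (energy of [g], two-ring allowance, dissipated norm),
   doubled by [hitting_energy], sum to [theta]. *)
have [B0 HB0] := recurrent_energy cinf_cond v cinf_rec (divr_gt0 theta0 (ltr0Sn R 5)).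
pose B := (B0 `|` B1 `|` [fset x0; v])%fset.
have B0B : (B0 `<=` B)%fset by rewrite /B -fsetUA fsubsetUl.
have B1B : (B1 `<=` B)%fset by rewrite /B fsetUAC fsubsetUr.
have x0B : x0 \in B by rewrite !inE eqxx orbT.
have vB : v \in B by rewrite !inE eqxx !orbT.
have [g [gv g01 gE]] := HB0 B B0B.
pose K := \sum_(x <- B) 2 * weight cinf x.
have w0 x : 0 <= 2 * weight cinf x by rewrite mulr_ge0 ?weight_ge0.
have K0 : 0 <= K by apply: sumr_ge0.
have KB : {in B, forall x, 2 * weight cinf x <= K}.
  by move=> x xB; rewrite /K (big_fsetD1 x)//= lerDl sumr_ge0.
pose b : R := (size B)%:R.
have b0 : 0 <= b by rewrite ler0n.
(* Time [s] is grid index [M], and the visits are sought during a further time [s * L']; [M] is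
   large enough to make the mesh [s / M] fine. *)
pose L' := (Num.truncn (6 * b / (s * theta))).+1.
pose M := (Num.truncn (4 * K * s + 6 * K ^+ 2 * s * b / theta)).+1.
have L'P : b / (s * L'%:R) <= theta / 6.
  have L'b : 6 * b / (s * theta) < L'%:R by exact: truncnS_gt.
  have sL : 0 < s * L'%:R by rewrite mulr_gt0// ltr0n.
  have st : 0 < s * theta by rewrite mulr_gt0.
  by rewrite ler_pdivrMr//; rewrite ltr_pdivrMr// in L'b; lra.
have M0 : 0 < M%:R :> R by rewrite ltr0n.
pose eta := s / M%:R.
have eta0 : 0 < eta by rewrite divr_gt0.
have MP : 4 * K * s + 6 * K ^+ 2 * s * b / theta <= M%:R.
  exact/ltW/truncnS_gt.
have b1 : 0 <= 6 * K ^+ 2 * s * b / theta.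
  by rewrite divr_ge0 ?(ltW theta0)// !mulr_ge0 ?sqr_ge0// ltW.
have Ks0 : 0 <= 4 * K * s by rewrite !mulr_ge0// ltW.
have Ksmall : 4 * (K * eta) <= 1.
  have -> : 4 * (K * eta) = 4 * K * s / M%:R by rewrite /eta; ring.
  by rewrite ler_pdivrMr// mul1r; lra.
have Keta : K ^+ 2 * eta * b <= theta / 6.
  have -> : K ^+ 2 * eta * b = K ^+ 2 * s * b / M%:R by rewrite /eta; ring.
  rewrite ler_pdivrMr//.
  have : 6 * K ^+ 2 * s * b / theta <= M%:R by lra.
  by rewrite ler_pdivrMr//; lra.
pose t (i : nat) : R := i%:R * eta.
have t0 : 0 <= t 0%N by rewrite /t mul0r.
have t_mono : {homo t : i j / (i <= j)%N >-> i <= j}.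
  by move=> i j ij; rewrite ler_wpM2r ?(ltW eta0)// ler_nat.
have t_ge0 i : 0 <= t i by rewrite mulr_ge0// ltW.
have tM : t M = s by rewrite /t /eta mulrC divfK// gt_eqF.
have i_bnd i x y : 0 <= intensity c t i x y <= eta * cinf x y.
  have /andP[lo hi] := grid_intensity i x y (ltW eta0); apply/andP; split.
    by apply: le_trans lo; rewrite mulr_ge0 ?(ltW eta0)//; case: (c_cond (t_ge0 i)).
  apply: le_trans hi _; rewrite ler_wpM2l ?(ltW eta0)//.
  exact: (conductance_le_limit c_mono c_lim _ _ (t_ge0 i.+1)).
have i_sym i x y := grid_intensity_sym i x y (ltW eta0).
have i_mono i x y : intensity c t i x y <= intensity c t i.+1 x y.
  have /andP[_ hi] := grid_intensity i x y (ltW eta0).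
  by have /andP[lo _] := grid_intensity i.+1 x y (ltW eta0); apply: le_trans lo.
have Ke1 : K * eta <= 4^-1 by move: Ksmall; lra.
pose a := box_rate c t eta K.
pose k := box_killing cinf B eta K.
pose stop (i : nat) (x : V) := (M <= i)%N && (x == v).
pose L := (M * L')%N.
pose h i := nat_rect (fun=> V -> R) (fun x => (x == v)%:R)
  (fun j => backward B (a (M + L - j.+1)%N) k (stop (M + L - j.+1)%N))
  (M + L - i)%N.
have h_eq i : (i < M + L)%N -> h i = backward B (a i) k (stop i) (h i.+1).
  move=> iML; rewrite /h; have -> : (M + L - i = (M + L - i.+1).+1)%N.
    by rewrite -subSn.
  by rewrite /=; congr (backward B (a _) k (stop _) _); rewrite -?subSn ?subSS ?subKn// ltnW.
have hT : h (M + L)%N = (fun x => (x == v)%:R) by rewrite /h subnn.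
have a_sym i x y : a i x y = a i y x by exact: box_rate_sym.
have a_ge0 i x y : 0 <= a i x y by exact: box_rate_ge0.
have a_mono i x y : a i x y <= a i.+1 x y.
  by rewrite /a /box_rate ler_wpM2l//; lra.
have k_ge0 : {in B, forall x, 0 <= k x} by move=> x _; exact: box_killing_ge0.
have half i : {in B, forall x, \sum_(y <- B) a i x y + k x <= 2^-1} by exact: box_half.
have E : dirichlet B (a M) k (h M) (h M) <= eta * theta.
  have L0 : (0 < L)%N by rewrite muln_gt0.
  have := hitting_energy a_sym a_ge0 a_mono k_ge0 half (fun _ _ => erefl) L0 gv g01 hT h_eq.
  have aT x y : a (M + L)%N x y <= eta * cinf x y.
    have /andP[I0 I1] := i_bnd (M + L)%N x y; apply: le_trans I1.
    by rewrite /a /box_rate ler_piMl//; have := mulr_ge0 K0 (ltW eta0); lra.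
  have := @terminal_energy B eta K (a (M + L)%N) g (ltW eta0) aT g01; rewrite -/k -/b => Dg.
  have bL : b / L%:R = eta * (b / (s * L'%:R)).
    rewrite /L natrM /eta; field.
    by rewrite !gt_eqF ?ltr0n.
  rewrite -/b bL => /le_trans; apply.
  have := ler_wpM2l (ltW eta0) L'P; have := ler_wpM2l (ltW eta0) Keta.
  have := ler_wpM2l (ltW eta0) gE; move: Dg; rewrite mulrDr; lra.
have drift := drift_backward a_sym a_ge0 a_mono k_ge0 half h_eq (leq_addr L M) x0B.
have DelE : (4 * C + s) * theta = (del / 2) ^+ 2 by rewrite /theta mulrC divfK// gt_eqF.
have hM1 : (h M v - h M x0) ^+ 2 <= (del / 2) ^+ 2.
  have := path s B (h M) (ltW s0s) B1B.
  set X := \sum_(y <- B) _ => hX.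
  (* One factor 2 is the 1/2 in [dirichlet]; the other comes from [1 - K * eta >= 1/2] in the box
     rates. *)
  have X4 : eta * X <= eta * (4 * theta).
    have XI : eta * X <= 2 * \sum_(x <- B) \sum_(y <- B)
        a M x y * (h M x - h M y) * (h M x - h M y).
      rewrite /X !mulr_sumr; apply: ler_sum => x _; rewrite !mulr_sumr.
      apply: ler_sum => y _.
      rewrite [leLHS]mulrA [leRHS](_ : _ = 2 * a M x y * (h M x - h M y) ^+ 2); last by ring.
      rewrite ler_wpM2r ?sqr_ge0//.
      have /andP[lo _] := grid_intensity M x y (ltW eta0).
      rewrite -/(t M) tM in lo; apply: le_trans lo _.
      have /andP[I0 _] := i_bnd M x y; rewrite /a /box_rate -/t.
      by move: I0 Ke1; nra.
    have K1 : 0 <= \sum_(x <- B) k x * h M x * h M x.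
      rewrite big_seq; apply: sumr_ge0 => x xB; rewrite -mulrA mulr_ge0 ?k_ge0//.
      by rewrite -expr2 sqr_ge0.
    by move: E; rewrite /dirichlet; lra.
  rewrite ler_pM2l// in X4.
  rewrite -[_ ^+ 2]sqrrN opprB; apply: le_trans hX _; rewrite -DelE.
  by have := ler_wpM2l C0 X4; have := mulr_ge0 (ltW sgt0) (ltW theta0); lra.
have h0M : (h M x0 - h 0%N x0) ^+ 2 <= (del / 2) ^+ 2.
  rewrite -[_ ^+ 2]sqrrN opprB; apply: le_trans drift _; rewrite -DelE.
  have := ler_wpM2l (ler0n R M) E.
  have -> : M%:R * (eta * theta) = s * theta by rewrite /eta; field; rewrite gt_eqF.
  by have := mulr_ge0 C0 (ltW theta0); lra.
have hMv : h M v = 1.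
  rewrite (backward_stop h_eq) ?leq_addr// ?hT ?eqxx// => j /andP[Mj _].
  by rewrite /stop Mj eqxx.
have h0 : 1 - del <= h 0%N x0.
  have sq (x : R) : x ^+ 2 <= (del / 2) ^+ 2 -> x <= del / 2.
    move=> x2; rewrite leNgt; apply/negP => xd; move: x2; rewrite leNgt => /negP; apply.
    by rewrite ltrXn2r// ltW// divr_gt0.
  by have := sq _ hM1; have := sq _ h0M; rewrite hMv; lra.
exists (reach N t B v M (M + L) 0 x0); split.
- exact: (measurable_reach clocks).
- have [_] := prob_reach clocks t0 t_mono cinf_cond i_bnd eta0 KB Ksmall K0
    (leq_addr L M) hT h_eq (fun=> fun=> false) (fun=> fun=> 0%N) (add0n _) x0B.
  have -> : past N t (fun=> fun=> false) (fun=> fun=> 0%N) 0 = [set: Omega].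
    by apply/seteqP; split => // w _; apply/pastP.
  by rewrite probability_setT mul1e setTI; apply: le_trans; rewrite lee_fin.
- move=> w T Y Hw fw; have start : at_vertex T Y (t 0%N) x0.
    by rewrite /t mul0r; exact: at_vertex_start fw.
  have [l Ml atl] := reach_visit t_mono fw Hw start.
  exists (t l) => //; rewrite -tM; exact: t_mono.
Qed.

End LateVisit.

(** * From late visits to recurrence and non-explosion *)

Lemma follows_clocks_nondecreasing (R : realType) (V : countType) (N : {fset V} -> set R)
    (x0 : V) (T : nat -> \bar R) (Y : nat -> V) :
  follows_clocks N x0 T Y -> nondecreasing_seq T.
Proof.
move=> [_ _ T_next _]; apply/nondecreasing_seqP => n.
rewrite T_next; exact: next_ring_ge.
Qed.

(** A visit at time [s] lies strictly before some jump time [T n.+1], so late visits make the jump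
    times unbounded. *)
Lemma visits_nonexplosion (R : realType) (V : countType) (T : nat -> \bar R)
    (Y : nat -> V) (v : V) :
  nondecreasing_seq T -> (forall r : R, exists2 s, r <= s & at_vertex T Y s v) ->
  explosion_time T = +oo%E /\
  forall t : R, finite_set [set n | (0 < n)%N /\ (T n <= t%:E)%E].
Proof.
move=> T_mono vis.
have late (r : R) : exists m, (r%:E < T m)%E.
  have [s rs [n [/andP[_ sn] _]]] := vis r; exists n.+1.
  by apply: le_lt_trans sn; rewrite lee_fin.
split.
  rewrite /explosion_time (cvg_lim _ (ereal_nondecreasing_cvgn T_mono))//.
  apply: eq_infty => r; have [m rm] := late r.
  by apply: le_trans (ltW rm) _; apply: ereal_sup_ubound; exists m.
move=> r; have [m rm] := late r.
apply: (sub_finite_set _ (finite_II m)) => n [_ nr] /=.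
rewrite ltnNge; apply/negP => mn.
by have := lt_le_trans rm (le_trans (T_mono _ _ mn) nr); rewrite ltxx.
Qed.

(** [Q] may be non-measurable: its failure lies in the intersection of the complements of events
    with probability tending to 1. *)
Lemma ae_large_events (R : realType) (d : measure_display) (Omega : measurableType d)
    (P : probability Omega R) (Q : Omega -> Prop) :
  (forall del : R, 0 < del -> exists H : set Omega,
    [/\ measurable H, ((1 - del)%:E <= P H)%E & H `<=` Q]) ->
  {ae P, forall w, Q w}.
Proof.
move=> large.
have /choice[H HP] (j : nat) : exists H : set Omega,
    [/\ measurable H, ((1 - j.+1%:R^-1)%:E <= P H)%E & H `<=` Q].
  by apply: large; rewrite invr_gt0.
have mH : measurable (\bigcap_j ~` H j).
  by apply: bigcap_measurable => // j _; apply: measurableC; case: (HP j).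
exists (\bigcap_j ~` H j); split=> //.
  apply/eqP; rewrite eq_le measure_ge0 andbT; apply/lee_addgt0Pr => e e0.
  pose j := Num.truncn e^-1; have [mHj PHj _] := HP j.
  have je : j.+1%:R^-1 <= e by rewrite invf_ple ?posrE// ltW// truncnS_gt.
  rewrite add0e; apply: (@le_trans _ _ (P (~` H j))).
    apply: le_measure; rewrite ?inE//; first exact: measurableC.
    exact: bigcap_inf.
  rewrite probability_setC// leeBlDr ?fin_num_measure//.
  rewrite -leeBlDl//; apply: le_trans PHj.
  by rewrite -EFinB lee_fin lerD2l lerN2.
by move=> w /= nQ j _ Hj; apply: nQ; case: (HP j) => _ _; apply.
Qed.
Unset Implicit Arguments.
Set Strict Implicit.
Set Printing Implicit Defensive.

Theorem theorem1p11 (R : realType) (V : countType)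
  (c : R -> V -> V -> R) (cinf : V -> V -> R)
  (c_cond : forall t, 0 <= t -> conductances (c t))
  (c_mono : forall s t u v, 0 <= s -> s <= t -> c s u v <= c t u v)
  (c_lim : forall u v, c t u v @[t --> +oo] --> cinf u v)
  (cinf_fin : forall v, (total_conductance cinf v < +oo)%E)
  (cinf_irr : network_irreducible cinf)
  (cinf_rec : network_recurrent cinf)
  (d : measure_display) (Omega : measurableType d) (P : probability Omega R)
  (N : {fset V} -> Omega -> set R) (x0 : V)
  (T : nat -> Omega -> \bar R) (Y : nat -> Omega -> V)
  (X_walk : random_walk P c N x0 T Y) :
  {ae P, forall w,
    [/\ explosion_time (fun n => T n w) = +oo%E,
        forall t : R, finite_set [set n | (0 < n)%N /\ (T n w <= t%:E)%E] &
        forall v, ~ has_ubound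
          [set t | 0 <= t /\ at_vertex (fun n => T n w) (fun n => Y n w) t v]]}.
Proof.
have [clocks _ _ follows] := X_walk.
have visit v n : {ae P, forall w,
    follows_clocks (fun e => N e w) x0 (fun n => T n w) (fun n => Y n w) ->
    exists2 r : R, n%:R <= r & at_vertex (fun n => T n w) (fun n => Y n w) r v}.
  apply: ae_large_events => del del0.
  have [s0 s00 late] := late_visit c_cond c_mono c_lim cinf_fin cinf_irr cinf_rec clocks x0 v.
  have [|H [mH PH HQ]] := late (s0 + n%:R + 1) del _ del0.
    by rewrite -addrA ltrDl ltr_wpDl.
  exists H; split=> // w Hw fw; have [r sr atr] := HQ w _ _ Hw fw.
  by exists r => //; apply: le_trans sr; lra.
(* The countably many pairs of a vertex and an integer time are coded by [k], so that one null set
   serves them all. *)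
have visits : {ae P, forall w, forall k,
    follows_clocks (fun e => N e w) x0 (fun n => T n w) (fun n => Y n w) ->
    if choice.unpickle k is Some (v, n) then
      exists2 r : R, n%:R <= r & at_vertex (fun n => T n w) (fun n => Y n w) r v
    else True}.
  apply/ae_foralln => k; case: choice.unpickle => [[v n]|]; first exact: visit.
  exact: aeW.
move: visits follows; apply: filterS2 => w visits fw.
have {}visits v (r : R) : exists2 s : R, r <= s &
    at_vertex (fun n => T n w) (fun n => Y n w) s v.
  have := visits (choice.pickle (v, (Num.truncn r).+1)) fw.
  rewrite choice.pickleK => -[s rs ats]; exists s => //.
  by apply: le_trans rs; apply/ltW/truncnS_gt.
have [expl fin] := visits_nonexplosion (follows_clocks_nondecreasing fw) (visits x0).
split=> // v [b ub]; have [s bs ats] := visits v (Num.max 0 (b + 1)).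
move: bs; rewrite ge_max => /andP[s0 bs].
by have := ub s (conj s0 ats); lra.
Qed.
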